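(* As $z$ ranges over the closed upper half-plane $\{z\in\mathbb C:\Im z\ge0\}$, the representations $T_z$ of $G$ are pairwise disjoint; that is, for distinct $z_1,z_2$ with $\Im z_1\ge0$, $\Im z_2\ge0$, the representations $T_{z_1}$ and $T_{z_2}$ have no equivalent nonzero subrepresentations.
   Context: $S(n)$ is the group of permutations of $\{1,\dots,n\}$, identified with the stabilizer of $n+1$ in $S(n+1)$; $S(\infty)=\bigcup_n S(n)$; $G=S(\infty)\times S(\infty)$, $G(n)=S(n)\times S(n)$. The canonical projection $p_{n,n+1}:S(n+1)\to S(n)$ removes $n+1$ from its cycle: for $1\le i\le n$, $(p_{n,n+1}(x))(i)=x(i)$ if $x(i)\le n$, and $=x(n+1)$ if $x(i)=n+1$. $H^n=L^2(S(n))$ with respect to the uniform probability measure; $\mathrm{Reg}^n$ is the representation of $G(n)$ in $H^n$, $(\mathrm{Reg}^n(g)f)(x)=f(g_2^{-1}xg_1)$. For $z\in\mathbb C$, $t=|z|^2$, the isometric $G(n)$-equivariant embedding $L_z^n:H^n\to H^{n+1}$ is $(L_z^nf)(x)=z\sqrt{\frac{n+1}{t+n}}f(x)$ for $x\in S(n)$ and $(L_z^nf)(x)=\sqrt{\frac{n+1}{t+n}}f(p_{n,n+1}(x))$ for $x\in S(n+1)\setminus S(n)$. The generalized regular representation $T_z$ of $G$ is the inductive limit of the $\mathrm{Reg}^n$ along the $L_z^n$; it acts in the Hilbert completion of $\bigcup_nH^n$. *)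

(* Defs.v *)
From HB Require Import structures.
From mathcomp Require Import all_boot all_order all_fingroup all_algebra.
From mathcomp Require Import complex ring.
From mathcomp Require Import all_classical all_reals topology normedtype.

Set Implicit Arguments.
Unset Strict Implicit.
Unset Printing Implicit Defensive.

Import Order.TTheory GRing.Theory Num.Theory.
Import numFieldNormedType.Exports.

Local Open Scope classical_set_scope.
Local Open Scope ring_scope.

(* The norm of a normed module over K takes its (nonnegative) values in K. *)
HB.mixin Record isHilbert (K : numClosedFieldType) V
    of CompleteNormedModule K V := {
  hdot : {dot V for @Num.conj K} ;
  hdot_norm : forall x : V, `|x| ^+ 2 = hdot x x }.

#[short(type="hilbertType")]
HB.structure Definition Hilbert (K : numClosedFieldType) :=
  {V of isHilbert K V & CompleteNormedModule K V}.

Section UnitaryRepresentations.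
Variables (K : numClosedFieldType) (G : groupType).

Record unitary_rep := UnitaryRep {
  rep_space :> hilbertType K ;
  rep_act : G -> {linear rep_space -> rep_space} ;
  rep_act1 : forall x, rep_act 1%g x = x ;
  rep_actM : forall g h x, rep_act (g * h)%g x = rep_act g (rep_act h x) ;
  rep_act_dot : forall g x y, hdot (rep_act g x) (rep_act g y) = hdot x y }.

Definition subrepresentation (T : unitary_rep) (W : set T) : Prop :=
  [/\ W 0,
      (forall a x y, W x -> W y -> W (a *: x + y)),
      closed W
    & forall g x, W x -> W (rep_act T g x)].

(* Unitary equivalence of the restrictions of T1 to W1 and of T2 to W2; the
   values of U outside W1 are irrelevant. *)
Definition equivalent_subrep (T1 T2 : unitary_rep) (W1 : set T1) (W2 : set T2)
    : Prop :=
  exists U : T1 -> T2,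
    [/\ (forall a x y, W1 x -> W1 y -> U (a *: x + y) = a *: U x + U y),
        (forall x y, W1 x -> W1 y -> hdot (U x) (U y) = hdot x y),
        U @` W1 = W2
      & forall g x, W1 x -> U (rep_act T1 g x) = rep_act T2 g (U x)].

Definition disjoint_rep (T1 T2 : unitary_rep) : Prop :=
  forall (W1 : set T1) (W2 : set T2),
    subrepresentation W1 -> subrepresentation W2 ->
    W1 <> [set 0] -> W2 <> [set 0] -> ~ equivalent_subrep W1 W2.

End UnitaryRepresentations.

(* The group of finitary permutations of nat. As in the library's groups 'S_n,
   permutations are composed from left to right: (s * t) i = t (s i). *)
Record Sinf := MkSinf {
  sinf_fun :> nat -> nat ;
  sinf_bij : bijective sinf_fun ;
  sinf_fin : exists n, forall i, (n <= i)%N -> sinf_fun i = i }.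

Section SinfGroup.

Lemma sinf_inj (s t : Sinf) : s =1 t -> s = t.
Proof.
case: s t => [f fb ff] [g gb gf] /= /funext fg; case: _ / fg in gb gf *.
by congr MkSinf; apply: Prop_irrelevance.
Qed.

HB.instance Definition _ := gen_eqMixin Sinf.
HB.instance Definition _ := gen_choiceMixin Sinf.

Lemma sinf1_fin : exists n, forall i, (n <= i)%N -> @id nat i = i.
Proof. by exists 0. Qed.
Definition sinf1 : Sinf := MkSinf (Bijective (g := id) (fun _ => erefl) (fun _ => erefl)) sinf1_fin.

Lemma sinfM_fin (s t : Sinf) :
  exists n, forall i, (n <= i)%N -> (t \o s) i = i.
Proof.
have [[n sn] [m tm]] := (sinf_fin s, sinf_fin t).
exists (maxn n m) => i; rewrite geq_max => /andP[ni mi] /=.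
by rewrite sn// tm.
Qed.
Definition sinfM (s t : Sinf) : Sinf :=
  MkSinf (bij_comp (sinf_bij t) (sinf_bij s)) (sinfM_fin s t).

Lemma sinf_inv_ex (s : Sinf) : exists g : nat -> nat, cancel s g /\ cancel g s.
Proof. by case: (sinf_bij s) => g; exists g. Qed.
Definition sinf_inv (s : Sinf) : nat -> nat := projT1 (cid (sinf_inv_ex s)).
Lemma sinf_funK (s : Sinf) : cancel s (sinf_inv s).
Proof. by rewrite /sinf_inv; case: cid => g []. Qed.
Lemma sinf_invK (s : Sinf) : cancel (sinf_inv s) s.
Proof. by rewrite /sinf_inv; case: cid => g []. Qed.
Lemma sinfV_fin (s : Sinf) :
  exists n, forall i, (n <= i)%N -> sinf_inv s i = i.
Proof.
by have [n sn] := sinf_fin s; exists n => i ni; rewrite -{1}(sn i ni) sinf_funK.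
Qed.
Definition sinfV (s : Sinf) : Sinf :=
  MkSinf (Bijective (@sinf_invK s) (@sinf_funK s)) (sinfV_fin s).

Lemma sinfMA : associative sinfM.
Proof. by move=> s t u; apply: sinf_inj. Qed.
Lemma sinf1M : left_id sinf1 sinfM.
Proof. by move=> s; apply: sinf_inj. Qed.
Lemma sinfM1 : right_id sinf1 sinfM.
Proof. by move=> s; apply: sinf_inj. Qed.
Lemma sinfVM : left_inverse sinf1 sinfV sinfM.
Proof. by move=> s; apply: sinf_inj => i /=; rewrite sinf_invK. Qed.
Lemma sinfMV : right_inverse sinf1 sinfV sinfM.
Proof. by move=> s; apply: sinf_inj => i /=; rewrite sinf_funK. Qed.

HB.instance Definition _ := isGroup.Build Sinf sinfMA sinf1M sinfM1 sinfVM sinfMV.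

End SinfGroup.

Section BiSinf.

Definition Sinf2 : Type := (Sinf * Sinf)%type.
HB.instance Definition _ := Choice.on Sinf2.

Definition Sinf2M (g h : Sinf2) : Sinf2 := (g.1 * h.1, g.2 * h.2)%g.
Definition Sinf2V (g : Sinf2) : Sinf2 := (g.1^-1, g.2^-1)%g.
Definition Sinf2_1 : Sinf2 := (1, 1)%g.

Lemma Sinf2MA : associative Sinf2M.
Proof. by move=> [a b] [c d] [e f]; rewrite /Sinf2M /= !mulgA. Qed.
Lemma Sinf2_1M : left_id Sinf2_1 Sinf2M.
Proof. by move=> [a b]; rewrite /Sinf2M /= !mul1g. Qed.
Lemma Sinf2_M1 : right_id Sinf2_1 Sinf2M.
Proof. by move=> [a b]; rewrite /Sinf2M /= !mulg1. Qed.
Lemma Sinf2VM : left_inverse Sinf2_1 Sinf2V Sinf2M.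
Proof. by move=> [a b]; rewrite /Sinf2M /= !mulVg. Qed.
Lemma Sinf2MV : right_inverse Sinf2_1 Sinf2V Sinf2M.
Proof. by move=> [a b]; rewrite /Sinf2M /= !mulgV. Qed.

HB.instance Definition _ :=
  isGroup.Build Sinf2 Sinf2MA Sinf2_1M Sinf2_M1 Sinf2VM Sinf2MV.

End BiSinf.

(* 'S_n acts on {0, ..., n-1}; ext_perm identifies it with the subgroup of the
   permutations of nat fixing every i >= n. *)
Section Embedding.
Variable n : nat.

Definition ext_fun (s : 'S_n) (i : nat) : nat :=
  if insub i is Some j then val (s j) else i.

Lemma ext_funM (s t : 'S_n) : ext_fun (s * t)%g =1 ext_fun t \o ext_fun s.
Proof.
move=> i; rewrite /ext_fun /=; case: (@insubP _ _ 'I_n i) => [j _ _|ni].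
  by rewrite valK permM.
by rewrite insubN.
Qed.

Lemma ext_fun1 : ext_fun 1%g =1 id.
Proof. by move=> i; rewrite /ext_fun; case: insubP => // j _ <-; rewrite perm1. Qed.

Lemma ext_fun_bij (s : 'S_n) : bijective (ext_fun s).
Proof.
exists (ext_fun s^-1%g) => i; have /= <- := ext_funM _ _ i;
  by rewrite ?mulgV ?mulVg ext_fun1.
Qed.

Lemma ext_fun_fin (s : 'S_n) : exists m, forall i, (m <= i)%N -> ext_fun s i = i.
Proof. by exists n => i ni; rewrite /ext_fun insubN// -leqNgt. Qed.

Definition ext_perm (s : 'S_n) : Sinf := MkSinf (ext_fun_bij s) (ext_fun_fin s).

End Embedding.

(* ord_max : 'I_n.+1 is the point added to {0, ..., n-1}, and lift ord_max is
   the inclusion of 'I_n into 'I_n.+1. The permutations x : 'S_n.+1 fixing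
   ord_max form the subgroup 'S_n, embedded by lift_perm ord_max ord_max. *)
Section CanonicalProjection.
Variable n : nat.

(* x ord_max equals ord_max only if x fixes ord_max, and then the odflt branch
   is never reached: the default value i is a dummy. *)
Definition cproj_fun (x : 'S_n.+1) (i : 'I_n) : 'I_n :=
  if unlift ord_max (x (lift ord_max i)) is Some j then j
  else odflt i (unlift ord_max (x ord_max)).

Lemma lift_cproj_fun (x : 'S_n.+1) (i : 'I_n) :
  lift ord_max (cproj_fun x i) =
    if x (lift ord_max i) == ord_max then x ord_max else x (lift ord_max i).
Proof.
rewrite /cproj_fun; case: unliftP => [j ->|xi].
  by rewrite lift_eqF.
rewrite xi eqxx; case: unliftP => [j -> //|xm].
by have /perm_inj/eqP := etrans xm (esym xi); rewrite eq_liftF.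
Qed.

Lemma cproj_fun_inj (x : 'S_n.+1) : injective (cproj_fun x).
Proof.
move=> i j /(congr1 (lift ord_max)); rewrite !lift_cproj_fun.
case: ifPn => [/eqP xi|_]; case: ifPn => [/eqP xj|_].
- by move=> _; apply: (@lift_inj _ ord_max); apply: (@perm_inj _ x); rewrite xi.
- by move/perm_inj/eqP; rewrite eq_liftF.
- by move/perm_inj/esym/eqP; rewrite eq_liftF.
- by move/perm_inj/lift_inj.
Qed.

Definition cproj (x : 'S_n.+1) : 'S_n := perm (@cproj_fun_inj x).

Lemma cproj_lift (y : 'S_n) : cproj (lift_perm ord_max ord_max y) = y.
Proof.
apply/permP => i; apply: (@lift_inj _ ord_max).
by rewrite permE lift_cproj_fun lift_perm_lift lift_eqF.
Qed.

End CanonicalProjection.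

Section GeneralizedRegular.
Variable R : realType.
Local Notation C := R[i].

(* L^2('S_n) for the uniform probability measure, with inner product dotn. *)
Definition Hn (n : nat) := {ffun 'S_n -> C}.

Definition dotn n (f g : Hn n) : C :=
  (n`!)%:R^-1 * \sum_(x : 'S_n) f x * (g x)^*.

Definition Reg n (g : 'S_n * 'S_n) (f : Hn n) : Hn n :=
  [ffun x => f (g.2^-1 * x * g.1)%g].

(* x ord_max == ord_max means that x lies in 'S_n, and then cproj x is x
   itself (cproj_lift). *)
Definition Lz (z : C) n (f : Hn n) : Hn n.+1 :=
  [ffun x : 'S_n.+1 =>
    (if x ord_max == ord_max then z else 1)
    * sqrtC (n.+1%:R / (`|z| ^+ 2 + n%:R)) * f (cproj x)].

(* T is a realization of the inductive limit T_z: its space is the Hilbert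
   completion of the union of the Hn n, n >= 1, glued along the isometries
   Lz z n. This determines T up to unitary equivalence; existence is proved in
   generalized_regular_exists. Level n = 0 is left out: for z = 0 the
   coefficient sqrt ((n + 1) / (t + n)) makes no sense there. *)
Definition is_generalized_regular (z : C) (T : unitary_rep C Sinf2) : Prop :=
  exists j : forall n, Hn n -> T,
    [/\ (forall n, (0 < n)%N ->
           [/\ (forall a f g, j n (a *: f + g) = a *: j n f + j n g),
               (forall f g, hdot (j n f) (j n g) = dotn f g)
             & (forall f, j n.+1 (Lz z f) = j n f)]),
        closure [set v | exists n, (0 < n)%N /\ range (j n) v] = setT
      & forall n (g : 'S_n * 'S_n) f, (0 < n)%N ->
          rep_act T (ext_perm g.1, ext_perm g.2) (j n f) = j n (Reg g f)].

End GeneralizedRegular.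

(* Existence of T_z. Elements of the algebraic inductive limit are represented
   by sequences compatible with Lz from some rank on; their completion is
   realized as the space of the pointwise limits of the functionals s (x k)
   attached to Cauchy sequences x. *)
Module Existence.

Section SeqLimits.
Variable K : numClosedFieldType.
Implicit Types (u v : nat -> K) (l m : K).

Definition clim u l : Prop :=
  forall e, 0 < e -> exists N, forall n, (N <= n)%N -> `|u n - l| < e.

Lemma clim_cst l : clim (fun=> l) l.
Proof. by move=> e e0; exists 0%N => n _; rewrite subrr normr0. Qed.

Lemma clim_eq u v l : (exists N, forall n, (N <= n)%N -> u n = v n) ->
  clim u l -> clim v l.
Proof.
move=> [N uv] ul e e0; have [M ulM] := ul _ e0; exists (maxn N M) => n.
by rewrite geq_max => /andP[Nn Mn]; rewrite -uv// ulM.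
Qed.

Lemma clim_le u l (c : K) :
  clim u l -> 0 <= c -> (exists N, forall n, (N <= n)%N -> `|u n| <= c) -> `|l| <= c.
Proof.
move=> ul c0 [N uc]; rewrite real_leNgt ?ger0_real// ; apply/negP => cl.
have [M ulM] := ul _ (etrans (subr_gt0 _ _) cl).
have := ulM _ (leq_maxr N M); apply/negP; rewrite -real_leNgt ?realB ?ger0_real//.
rewrite lerBlDr distrC (le_trans _ (lerD (lexx _) (uc _ (leq_maxl N M))))//.
by rewrite -{1}(subrK (u (maxn N M)) l) ler_normD.
Qed.

Lemma climD u v l m : clim u l -> clim v m -> clim (fun n => u n + v n) (l + m).
Proof.
move=> ul vm e e0; have e20 : 0 < e / 2 by rewrite divr_gt0.
have [N uN] := ul _ e20; have [M vM] := vm _ e20; exists (maxn N M) => n.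
rewrite geq_max => /andP[Nn Mn].
rewrite opprD addrACA (le_lt_trans (ler_normD _ _))// [e]splitr.
by rewrite ltrD ?uN ?vM.
Qed.

Lemma climZ a u l : clim u l -> clim (fun n => a * u n) (a * l).
Proof.
move=> ul e e0; have a0 : 0 < `|a| + 1 by rewrite ltr_wpDl.
have [N uN] := ul _ (divr_gt0 e0 a0); exists N => n Nn.
rewrite -mulrBr normrM (@le_lt_trans _ _ ((`|a| + 1) * `|u n - l|))//.
  by rewrite ler_wpM2r// lerDl.
by rewrite mulrC -ltr_pdivlMr// uN.
Qed.

Lemma climC u l : clim u l -> clim (fun n => (u n)^*) l^*.
Proof.
by move=> ul e /ul[N uN]; exists N => n Nn; rewrite -rmorphB norm_conjC uN.
Qed.

Lemma clim_uniq u l m : clim u l -> clim u m -> l = m.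
Proof.
move=> ul um; apply/eqP; rewrite -subr_eq0 -normr_le0.
have := climD ul (climZ (-1) um); rewrite mulN1r => /clim_le; apply => //.
by exists 0%N => n _; rewrite mulN1r subrr normr0.
Qed.

Lemma clim_ge0 u l : clim u l -> (forall n, 0 <= u n) -> 0 <= l.
Proof.
move=> ul u0; suff lE : l = `|l| by rewrite lE.
apply: (clim_uniq ul) => e /ul[N uN]; exists N => n /uN.
by apply: le_lt_trans; rewrite -{1}(ger0_norm (u0 n)) ler_dist_dist.
Qed.

End SeqLimits.

Section Completion.
Variables (K : numClosedFieldType) (E : lmodType K) (s : E -> E -> K).
Hypothesis K_complete : forall u : nat -> K,
  (forall e, 0 < e -> exists N, forall m n, (N <= m)%N -> (N <= n)%N ->
     `|u m - u n| < e) -> exists l, clim u l.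
Hypothesis K_arch : forall e : K, 0 < e ->
  exists N, forall n, (N <= n)%N -> n.+1%:R^-1 < e.
Hypothesis sP : forall a x y z, s (a *: x + y) z = a * s x z + s y z.
Hypothesis sC : forall x y, s x y = (s y x)^*.
Hypothesis s_ge0 : forall x, 0 <= s x x.

Lemma sD x y z : s (x + y) z = s x z + s y z.
Proof. by rewrite -[x in LHS]scale1r sP mul1r. Qed.
Lemma s0 z : s 0 z = 0.
Proof. by apply: (addrI (s 0 z)); rewrite -sD !addr0. Qed.
Lemma sZ a x z : s (a *: x) z = a * s x z.
Proof. by rewrite -[_ *: _]addr0 sP s0 addr0. Qed.
Lemma sB x y z : s (x - y) z = s x z - s y z.
Proof. by rewrite sD -scaleN1r sZ mulN1r. Qed.
Lemma sDr z x y : s z (x + y) = s z x + s z y.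
Proof. by rewrite sC sD rmorphD /= -!sC. Qed.
Lemma sZr a z x : s z (a *: x) = a^* * s z x.
Proof. by rewrite sC sZ rmorphM /= -sC. Qed.
Lemma sBr z x y : s z (x - y) = s z x - s z y.
Proof. by rewrite sC sB rmorphB /= -!sC. Qed.

Lemma s_expand x y a : s (x + a *: y) (x + a *: y) =
  s x x + (a^* * s x y + a * (s x y)^*) + a * a^* * s y y.
Proof. by rewrite sD !sDr !sZ !sZr -(sC y x); ring. Qed.

Lemma s_CS x y : `|s x y| ^+ 2 <= s x x * s y y.
Proof.
have sJ z : (s z z)^* = s z z by rewrite -sC.
have [y0|y0] := eqVneq (s y y) 0; last first.
  have yp : 0 < s y y by rewrite lt_def y0 s_ge0.
  have := s_ge0 (x + (- (s x y / s y y)) *: y).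
  rewrite s_expand rmorphN fmorph_div /= sJ.
  rewrite (_ : _ + _ = s x x - s x y * (s x y)^* / s y y); last by field.
  by rewrite subr_ge0 ler_pdivrMr// -normCK.
have [->|xy0] := eqVneq (s x y) 0; first by rewrite normr0 expr0n mulr_ge0.
pose t := (s x x + 1) / `|s x y| ^+ 2.
have tJ : t^* = t.
  by apply/CrealP/ger0_real; rewrite divr_ge0 ?exprn_ge0// addr_ge0.
have := s_ge0 (x + (- (t * s x y)) *: y).
rewrite s_expand y0 mulr0 addr0 rmorphN rmorphM /= tJ.
rewrite (_ : _ + _ = s x x - 2 * (t * (s x y * (s x y)^* ))); last by ring.
rewrite -normCK divfK ?expf_neq0 ?normr_eq0// => h; exfalso.
have : 0 <= - (s x x + 2).
  by apply: le_trans h _; rewrite le_eqVlt; apply/orP; left; apply/eqP; ring.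
by rewrite oppr_ge0 => /(lt_le_trans (ltr_wpDl (s_ge0 x) (ltr0n _ 2))); rewrite ltxx.
Qed.

Definition nx x : K := sqrtC (s x x).
Lemma nx_ge0 x : 0 <= nx x. Proof. by rewrite sqrtC_ge0. Qed.
Lemma nxE x : nx x ^+ 2 = s x x. Proof. exact: sqrtCK. Qed.
Hint Resolve nx_ge0 : core.

Lemma CSn x y : `|s x y| <= nx x * nx y.
Proof.
rewrite -(@ler_pXn2r _ 2) ?nnegrE ?mulr_ge0//.
by rewrite exprMn !nxE s_CS.
Qed.

Lemma nxD x y : nx (x + y) <= nx x + nx y.
Proof.
rewrite -(@ler_pXn2r _ 2) ?nnegrE ?addr_ge0// nxE sqrrD !nxE.
have := s_expand x y 1; rewrite scale1r rmorph1 !mul1r => ->; rewrite lerD2r lerD2l.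
have rR : s x y + (s x y)^* \is Num.real.
  by apply/CrealP; rewrite rmorphD /= conjCK addrC.
apply: (le_trans (real_ler_norm rR)); apply: (le_trans (ler_normD _ _)).
by rewrite norm_conjC -mulr2n lerMn2r CSn orbT.
Qed.

Lemma nxZ a x : nx (a *: x) = `|a| * nx x.
Proof.
apply/eqP; rewrite -(@eqrXn2 _ 2) ?mulr_ge0// nxE sZ sZr exprMn nxE normCK.
by rewrite mulrA.
Qed.
Lemma nxN x : nx (- x) = nx x.
Proof. by rewrite -scaleN1r nxZ normrN1 mul1r. Qed.
Lemma nx0 : nx 0 = 0. Proof. by rewrite /nx s0 sqrtC0. Qed.

Definition cau (x : nat -> E) : Prop := forall e, 0 < e ->
  exists N, forall m n, (N <= m)%N -> (N <= n)%N -> nx (x m - x n) < e.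

Lemma cauP a x y : cau x -> cau y -> cau (fun k => a *: x k + y k).
Proof.
move=> cx cy e e0; have a0 : 0 < `|a| + 1 by rewrite ltr_wpDl.
have e20 : 0 < e / 2 by rewrite divr_gt0.
have [N hN] := cx _ (divr_gt0 e20 a0); have [M hM] := cy _ e20.
exists (maxn N M) => m n; rewrite !geq_max => /andP[Nm Mm] /andP[Nn Mn].
rewrite opprD addrACA -scalerBr (le_lt_trans (nxD _ _))// [e]splitr.
rewrite ltrD ?hM// nxZ (@le_lt_trans _ _ ((`|a| + 1) * nx (x m - x n)))//.
  by rewrite ler_wpM2r// lerDl.
by rewrite mulrC -ltr_pdivlMr// hN.
Qed.

Lemma cau_cst x : cau (fun=> x).
Proof. by move=> e e0; exists 0%N => m n _ _; rewrite subrr nx0. Qed.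

Lemma cau_bdd x : cau x -> exists2 B, 0 < B & forall k, nx (x k) <= B.
Proof.
move=> /(_ 1 ltr01)[N hN].
exists (1 + nx (x N) + \sum_(i < N) nx (x i)).
  by rewrite ltr_pwDl// ?sumr_ge0// ltr_pwDl.
move=> k; have [Nk|kN] := leqP N k.
  rewrite ler_wpDr ?sumr_ge0//.
  rewrite -{1}(subrK (x N) (x k)) (le_trans (nxD _ _))// lerD2r ltW// hN//.
rewrite (bigD1 (Ordinal kN))//= addrCA ler_wpDr// addr_ge0 ?sumr_ge0// addr_ge0//.
Qed.

Lemma cau_s x y : cau x -> cau y -> exists l, clim (fun k => s (x k) (y k)) l.
Proof.
move=> cx cy; have [A A0 xA] := cau_bdd cx; have [B B0 yB] := cau_bdd cy.
apply: K_complete => e e0; have e20 : 0 < e / 2 by rewrite divr_gt0.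
have [N hN] := cx _ (divr_gt0 e20 B0); have [M hM] := cy _ (divr_gt0 e20 A0).
exists (maxn N M) => m n; rewrite !geq_max => /andP[Nm Mm] /andP[Nn Mn].
rewrite (_ : _ - _ = s (x m - x n) (y m) + s (x n) (y m - y n)); last first.
  by rewrite sB sBr; ring.
rewrite (le_lt_trans (ler_normD _ _))// [e]splitr ltrD//.
  rewrite (le_lt_trans (CSn _ _))// (@le_lt_trans _ _ (nx (x m - x n) * B))//.
    by rewrite ler_wpM2l.
  by rewrite -ltr_pdivlMr// hN.
rewrite (le_lt_trans (CSn _ _))// (@le_lt_trans _ _ (A * nx (y m - y n)))//.
  by rewrite ler_wpM2r.
by rewrite mulrC -ltr_pdivlMr// hM.
Qed.

Lemma cau_null d : cau d -> (forall y, clim (fun k => s (d k) y) 0) ->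
  clim (fun k => s (d k) (d k)) 0.
Proof.
move=> cd d0 e e0; have [B B0 dB] := cau_bdd cd.
have e20 : 0 < e / 2 by rewrite divr_gt0.
have [N hN] := cd _ (divr_gt0 e20 B0); have [M hM] := d0 (d N) _ e20.
exists (maxn N M) => n; rewrite geq_max => /andP[Nn Mn]; rewrite subr0.
rewrite -[d n in X in s _ X](subrK (d N)) addrC sDr.
rewrite (le_lt_trans (ler_normD _ _))// [e]splitr ltrD//.
  by rewrite -[s _ _]subr0 hM.
rewrite (le_lt_trans (CSn _ _))// (@le_lt_trans _ _ (B * nx (d n - d N)))//.
  by rewrite ler_wpM2r.
by rewrite mulrC -ltr_pdivlMr// hN.
Qed.

Definition represents (x : nat -> E) (phi : E -> K) : Prop :=
  cau x /\ forall y, clim (fun k => s (x k) y) (phi y).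

Lemma representsP a x y phi psi : represents x phi -> represents y psi ->
  represents (fun k => a *: x k + y k) (fun z => a * phi z + psi z).
Proof.
move=> [cx xp] [cy yp]; split=> [|z]; first exact: cauP.
apply: clim_eq (climD (climZ a (xp z)) (yp z)).
by exists 0%N => n _; rewrite sP.
Qed.

Lemma represents_uniq x x' y y' phi psi l l' :
  represents x phi -> represents x' phi -> represents y psi -> represents y' psi ->
  clim (fun k => s (x k) (y k)) l -> clim (fun k => s (x' k) (y' k)) l' -> l = l'.
Proof.
move=> rx rx' ry ry' sl sl'.
have main z z' w chi theta : represents z chi -> represents z' chi ->
    represents w theta -> clim (fun k => s (z k - z' k) (w k)) 0.
  move=> rz rz' [cw _]; have [B B0 wB] := cau_bdd cw.
  have [cd dp] := representsP (-1) rz' rz.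
  have {}dp y0 : clim (fun k => s (-1 *: z' k + z k) y0) 0.
    by have := dp y0; rewrite mulN1r addNr.
  have h := cau_null cd dp; move=> e e0.
  have [N hN] := h _ (exprn_gt0 2 (divr_gt0 e0 B0)); exists N => n /hN.
  rewrite !subr0 scaleN1r addrC => hn.
  rewrite (le_lt_trans (CSn _ _))// (@le_lt_trans _ _ (nx (z n - z' n) * B))//.
    by rewrite ler_wpM2l.
  rewrite -ltr_pdivlMr// -(@ltr_pXn2r _ 2) ?nnegrE ?divr_ge0 ?(ltW e0) ?(ltW B0)//.
  by rewrite nxE (le_lt_trans _ hn)// real_ler_norm ?ger0_real.
have h1 := main _ _ _ _ _ rx rx' ry; have h2 := main _ _ _ _ _ ry ry' rx'.
have h3 := climD (climD (climC h2) h1) sl'.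
rewrite conjC0 !add0r in h3; apply: (clim_uniq sl); apply: clim_eq h3.
by exists 0%N => n _; rewrite -sC !(sB, sBr); ring.
Qed.

Definition cmpl_pred : {pred E -> K^o} :=
  let _ := (K_complete, (K_arch, (sP, (sC, s_ge0)))) in
  fun phi => `[< exists x, represents x phi >].

Lemma cmpl_submod : submod_closed cmpl_pred.
Proof.
split=> [|a phi psi].
  apply/asboolP; exists (fun=> 0); split; first exact: cau_cst.
  by move=> y; rewrite s0; apply: clim_cst.
move=> /asboolP[x rx] /asboolP[y ry]; apply/asboolP.
by exists (fun k => a *: x k + y k); apply: representsP.
Qed.

Record cmpl := Cmpl { cmpl_fun : E -> K^o ; _ : cmpl_fun \in cmpl_pred }.
HB.instance Definition _ := [isSub for cmpl_fun].
HB.instance Definition _ := [Choice of cmpl by <:].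
HB.instance Definition _ := GRing.SubChoice_isSubLmodule.Build K (E -> K^o) cmpl_pred cmpl cmpl_submod.

Lemma cmplE a (p q : cmpl) z :
  cmpl_fun (a *: p + q) z = a * cmpl_fun p z + cmpl_fun q z.
Proof. by have /= -> := linearP (val : cmpl -> (E -> K^o)) a p q. Qed.

Lemma cmpl_repr (p : cmpl) : exists x, represents x (cmpl_fun p).
Proof. exact/asboolP/(valP p). Qed.

Definition cseq (p : cmpl) : nat -> E := projT1 (cid (cmpl_repr p)).
Lemma cseqP (p : cmpl) : represents (cseq p) (cmpl_fun p).
Proof. by rewrite /cseq; case: cid. Qed.

Definition cdot (p q : cmpl) : K :=
  projT1 (cid (cau_s (proj1 (cseqP p)) (proj1 (cseqP q)))).

Lemma cdotE (p q : cmpl) x y :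
  represents x (cmpl_fun p) -> represents y (cmpl_fun q) ->
  clim (fun k => s (x k) (y k)) (cdot p q).
Proof.
move=> rx ry; have [l lP] := cau_s (proj1 rx) (proj1 ry).
rewrite /cdot; case: cid => m /= mP.
by rewrite (represents_uniq (cseqP p) rx (cseqP q) ry mP lP).
Qed.

Lemma cdotP a p q r : cdot (a *: p + q) r = a * cdot p r + cdot q r.
Proof.
have rp := cseqP p; have rq := cseqP q; have rr := cseqP r.
have rpq : represents (fun k => a *: cseq p k + cseq q k) (cmpl_fun (a *: p + q)).
  rewrite (_ : cmpl_fun _ = fun z => a * cmpl_fun p z + cmpl_fun q z).
    exact: representsP.
  by apply/funext => z; rewrite cmplE.
apply: (clim_uniq (cdotE rpq rr)).
apply: clim_eq (climD (climZ a (cdotE rp rr)) (cdotE rq rr)).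
by exists 0%N => n _; rewrite sP.
Qed.

Lemma cdotC p q : cdot p q = (cdot q p)^*.
Proof.
apply: (clim_uniq (cdotE (cseqP p) (cseqP q))).
apply: clim_eq (climC (cdotE (cseqP q) (cseqP p))).
by exists 0%N => n _; rewrite -sC.
Qed.

Lemma cdot_ge0 p : 0 <= cdot p p.
Proof. by apply: (clim_ge0 (cdotE (cseqP p) (cseqP p))) => n. Qed.

Lemma cdot_eq0 p : cdot p p = 0 -> p = 0.
Proof.
move=> p0; apply: val_inj; rewrite [RHS]linear0; apply/funext => y /=.
have [_ /(_ y) py] := cseqP p; apply: (clim_uniq py) => e e0.
have y0 : 0 < nx y + 1 by rewrite ltr_wpDl.
have := cdotE (cseqP p) (cseqP p); rewrite p0.
move=> /(_ _ (exprn_gt0 2 (divr_gt0 e0 y0)))[N hN]; exists N => n /hN.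
rewrite !subr0 => hn; rewrite (le_lt_trans (CSn _ _))//.
rewrite (@le_lt_trans _ _ (nx (cseq p n) * (nx y + 1)))//.
  by rewrite ler_wpM2l// lerDl.
rewrite -ltr_pdivlMr// -(@ltr_pXn2r _ 2) ?nnegrE ?divr_ge0 ?(ltW e0) ?(ltW y0)//.
by rewrite nxE (le_lt_trans _ hn)// real_ler_norm ?ger0_real.
Qed.

Lemma cmpl_inj_subproof x : (fun y => s x y : K^o) \in cmpl_pred.
Proof.
apply/asboolP; exists (fun=> x); split; first exact: cau_cst.
by move=> y; apply: clim_cst.
Qed.
Definition cmpl_inj x : cmpl := Cmpl (cmpl_inj_subproof x).

Lemma cmpl_inj_repr x : represents (fun=> x) (cmpl_fun (cmpl_inj x)).
Proof. by split=> [|y]; [exact: cau_cst|exact: clim_cst]. Qed.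

Lemma cmpl_injP a x y : cmpl_inj (a *: x + y) = a *: cmpl_inj x + cmpl_inj y.
Proof.
by apply: val_inj; apply/funext => z; rewrite [RHS]cmplE /= sP.
Qed.

Lemma cdot_inj x y : cdot (cmpl_inj x) (cmpl_inj y) = s x y.
Proof.
apply: (clim_uniq (cdotE (cmpl_inj_repr x) (cmpl_inj_repr y))); exact: clim_cst.
Qed.

End Completion.

Section CompletionHilbert.
Variables (K : numClosedFieldType) (E : lmodType K) (s : E -> E -> K).
Hypothesis K_complete : forall u : nat -> K,
  (forall e, 0 < e -> exists N, forall m n, (N <= m)%N -> (N <= n)%N ->
     `|u m - u n| < e) -> exists l, clim u l.
Hypothesis K_arch : forall e : K, 0 < e ->
  exists N, forall n, (N <= n)%N -> n.+1%:R^-1 < e.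
Hypothesis sP : forall a x y z, s (a *: x + y) z = a * s x z + s y z.
Hypothesis sC : forall x y, s x y = (s y x)^*.
Hypothesis s_ge0 : forall x, 0 <= s x x.

Local Notation hcmpl := (cmpl K_complete K_arch sP sC s_ge0).

Local Notation hd := (@cdot K E s K_complete K_arch sP sC s_ge0).
Local Notation hi := (@cmpl_inj K E s K_complete K_arch sP sC s_ge0).

Lemma hdP a p q r : hd (a *: p + q) r = a * hd p r + hd q r.
Proof. exact: cdotP. Qed.
Lemma hdC p q : hd p q = (hd q p)^*.
Proof. exact: cdotC. Qed.
Lemma hd_ge0 p : 0 <= hd p p.
Proof. exact: cdot_ge0. Qed.
Lemma hd_eq0 p : hd p p = 0 -> p = 0.
Proof. exact: cdot_eq0. Qed.

Let normr0_hd p : nx hd p = 0 -> p = 0.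
Proof. by move/eqP; rewrite sqrtC_eq0 => /eqP/hd_eq0. Qed.

HB.instance Definition _ := Lmodule_isNormed.Build K hcmpl
  (nxD hdP hdC hd_ge0) (nxZ hdP hdC hd_ge0) normr0_hd.

Lemma hnormE (p : hcmpl) : `|p| = nx hd p. Proof. by []. Qed.

Let hnorm_le (p : hcmpl) x c : represents s x (cmpl_fun p) -> 0 <= c ->
  (exists N, forall n, (N <= n)%N -> nx s (x n) <= c) -> `|p| <= c.
Proof.
move=> rx c0 [N xc]; rewrite hnormE -(@ler_pXn2r _ 2) ?nnegrE ?nx_ge0//; last first.
  exact: hd_ge0.
rewrite nxE -(ger0_norm (hd_ge0 p)).
apply: (clim_le (cdotE rx rx)); first by rewrite exprn_ge0.
exists N => n Nn; rewrite ger0_norm ?s_ge0// -nxE.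
by rewrite ler_pXn2r ?nnegrE ?nx_ge0 ?xc.
Qed.

Let hiB_repr (p : hcmpl) x (y : E) : represents s x (cmpl_fun p) ->
  represents s (fun k => -1 *: y + x k) (cmpl_fun (-1 *: hi y + p)).
Proof.
move=> rx; rewrite (_ : cmpl_fun _ = fun z => -1 * cmpl_fun (hi y) z + cmpl_fun p z).
  by apply: representsP => //; exact: (cmpl_inj_repr K_complete K_arch sP sC s_ge0 y).
by apply/funext => z; rewrite cmplE.
Qed.

Let hi_dist (p : hcmpl) x y c : represents s x (cmpl_fun p) -> 0 <= c ->
  (exists N, forall n, (N <= n)%N -> nx s (x n - y) <= c) -> `|p - hi y| <= c.
Proof.
move=> rx c0 [N xc]; rewrite addrC -scaleN1r; apply: (hnorm_le (hiB_repr y rx) c0).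
by exists N => n Nn; rewrite scaleN1r addrC xc.
Qed.

Lemma hi_dense (p : hcmpl) e : 0 < e -> exists x, `|p - hi x| < e.
Proof.
move=> e0; have e20 : 0 < e / 2 by rewrite divr_gt0.
have rp := cseqP p; have [N hN] := proj1 rp _ e20; exists (cseq p N).
have e2 : e / 2 < e by rewrite gtr_pMr// invf_lt1// ltr1n.
apply: le_lt_trans e2; apply: (hi_dist rp (ltW e20)).
by exists N => n Nn; rewrite ltW// hN.
Qed.

Let hi_norm x : `|hi x| = nx s x.
Proof. by rewrite hnormE /nx cdot_inj. Qed.
Let hiB x y : hi (x - y) = hi x - hi y.
Proof. by rewrite addrC -scaleN1r cmpl_injP scaleN1r addrC. Qed.

Lemma hcmpl_complete (F : set_system hcmpl) : ProperFilter F -> cauchy F -> cvg F.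
Proof.
move=> FF /cauchyP Fc.
have inv0 n : 0 < n.+1%:R^-1 :> K by rewrite invr_gt0.
have /choice[q Fq] : forall n : nat, exists q, F (ball (q : hcmpl) (n.+1%:R^-1 : K)).
  by move=> n; apply: Fc.
have /choice[x qx] : forall n : nat, exists x, `|q n - hi x| < n.+1%:R^-1 :> K.
  by move=> n; apply: hi_dense.
have qq m n : `|q m - q n| < m.+1%:R^-1 + n.+1%:R^-1.
  have [r [/= rm rn]] := filter_ex (filterI (Fq m) (Fq n)).
  rewrite -(subrKA r) (le_lt_trans (ler_normD _ _))// ltrD//.
  by rewrite distrC.
have cx : cau s x.
  move=> e e0; have e40 : 0 < e / 2 / 2 by rewrite !divr_gt0.
  have [N hN] := K_arch e40; exists N => m n Nm Nn.
  rewrite -hi_norm hiB -(subrKA (q m)) (le_lt_trans (ler_normD _ _))//.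
  pose h := e / 2 / 2; have hE : e = h + (h + h + h) by rewrite /h; field.
  apply: (@lt_le_trans _ _ (h + (h + h + h))); last by rewrite -hE.
  apply: ltrD; first by rewrite distrC (lt_trans (qx m))// hN.
  rewrite -(subrKA (q n)) (le_lt_trans (ler_normD _ _))//.
  apply: ltrD; last by rewrite (lt_trans (qx n))// hN.
  by rewrite (lt_trans (qq m n))//; apply: ltrD; apply: hN.
have /choice[phi phiP] : forall y, exists l, clim (fun k => s (x k) y) l.
  by move=> y; apply: (cau_s K_complete sP sC s_ge0 cx); exact: cau_cst.
have rx : represents s x phi by split.
have pP : (phi : E -> K^o) \in cmpl_pred K_complete K_arch sP sC s_ge0.
  by apply/asboolP; exists x.
pose p : hcmpl := Cmpl pP.
apply/cvg_ex; exists p; apply/cvg_ballP => e e0.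
have e20 : 0 < e / 2 by rewrite divr_gt0.
have e40 : 0 < e / 2 / 2 by rewrite divr_gt0.
have [M hM] := cx _ e40; have [N hN] := K_arch e40.
pose h := e / 2 / 2; set n := maxn M N.
have hE : e = h + h + h + h by rewrite /h; field.
have nN : n.+1%:R^-1 < h by rewrite hN// leq_maxr.
apply: filterS (Fq n) => r qr.
have {}qr : `|q n - r| < h by apply: lt_trans nN; apply: qr.
suff : `|p - r| < e by [].
apply: (@lt_le_trans _ _ (h + h + h)); last by rewrite {1}hE lerDl ltW.
rewrite -(subrKA (q n)) (le_lt_trans (ler_normD _ _))//.
apply: ltrD => //.
rewrite -(subrKA (hi (x n))) (le_lt_trans (ler_normD _ _))//.
apply: ler_ltD; last by rewrite distrC (lt_trans (qx n)).
apply: (hi_dist (p := p) rx (ltW e40)); exists M => k Mk.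
by rewrite ltW// hM// leq_maxl.
Qed.

HB.instance Definition _ := Uniform_isComplete.Build hcmpl hcmpl_complete.

Let hd_bilin : bilinear_for
  (GRing.Scale.Law.clone _ _ ( *%R ) _) (GRing.Scale.Law.clone _ _ (@Num.conj K \; *%R) _) hd.
Proof.
split=> [q|p] a x y /=; first by rewrite hdP.
by rewrite (sDr hdP hdC) (sZr hdP hdC).
Qed.
HB.instance Definition _ := bilinear_isBilinear.Build K hcmpl hcmpl K _ _ hd hd_bilin.
Let hd_herm p q : hd p q = (-1) ^+ false * Num.conj (hd q p).
Proof. by rewrite expr0 mul1r -hdC. Qed.
HB.instance Definition _ := isHermitianSesquilinear.Build K hcmpl false (@Num.conj K) hd hd_herm.
Let hd_dot p : p != 0 -> 0 < hd p p.
Proof. by move=> p0; rewrite lt_def hd_ge0 andbT; apply: contra p0 => /eqP/hd_eq0/eqP. Qed.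
HB.instance Definition _ := isDotProduct.Build K hcmpl hd hd_dot.

HB.instance Definition _ := isHilbert.Build K hcmpl (fun p => nxE hd p).

Lemma hdot_hi x y : hdot (hi x) (hi y) = s x y.
Proof. exact: cdot_inj. Qed.

End CompletionHilbert.

Section CompletionRepresentation.
Variables (K : numClosedFieldType) (E : lmodType K) (s : E -> E -> K).
Hypothesis K_complete : forall u : nat -> K,
  (forall e, 0 < e -> exists N, forall m n, (N <= m)%N -> (N <= n)%N ->
     `|u m - u n| < e) -> exists l, clim u l.
Hypothesis K_arch : forall e : K, 0 < e ->
  exists N, forall n, (N <= n)%N -> n.+1%:R^-1 < e.
Hypothesis sP : forall a x y z, s (a *: x + y) z = a * s x z + s y z.
Hypothesis sC : forall x y, s x y = (s y x)^*.
Hypothesis s_ge0 : forall x, 0 <= s x x.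
Variables (G : groupType) (act : G -> E -> E).
Hypothesis act1 : forall x y, s x (act 1%g y) = s x y.
Hypothesis actM : forall g h x y, s x (act (g * h)%g y) = s x (act g (act h y)).
Hypothesis act_adj : forall g x y, s (act g x) y = s x (act g^-1%g y).

Local Notation hcmpl := (cmpl K_complete K_arch sP sC s_ge0).
Local Notation hi := (@cmpl_inj K E s K_complete K_arch sP sC s_ge0).

Let act_isom g x y : s (act g x) (act g y) = s x y.
Proof. by rewrite act_adj -actM mulVg act1. Qed.

Let actB g x y : nx s (act g x - act g y) = nx s (x - y).
Proof.
rewrite /nx; congr sqrtC.
rewrite !(sB sP) !(sBr sP sC) !act_isom.
by rewrite -!(sBr sP sC) -!(sB sP).
Qed.

Lemma act_repr g x phi : represents s x phi ->
  represents s (fun k => act g (x k)) (fun y => phi (act g^-1%g y)).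
Proof.
move=> [cx xp]; split=> [e /cx[N hN]|y].
  by exists N => m n Nm Nn; rewrite actB hN.
by apply: clim_eq (xp (act g^-1%g y)); exists 0%N => n _; rewrite act_adj.
Qed.

Lemma cact_subproof g (p : hcmpl) :
  (fun y => cmpl_fun p (act g^-1%g y) : K^o) \in cmpl_pred K_complete K_arch sP sC s_ge0.
Proof.
apply/asboolP; exists (fun k => act g (cseq p k)).
exact: act_repr (cseqP p).
Qed.
Definition cact g (p : hcmpl) : hcmpl := Cmpl (cact_subproof g p).

Let cact_linear g : linear (cact g).
Proof.
by move=> a p q; apply: val_inj; apply/funext => y; rewrite [RHS]cmplE; exact: cmplE.
Qed.
HB.instance Definition _ g := GRing.isLinear.Build K hcmpl hcmpl _ (cact g) (cact_linear g).

Let cmpl_ext (p : hcmpl) y y' : (forall x, s x y = s x y') -> cmpl_fun p y = cmpl_fun p y'.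
Proof.
move=> yy; have [_ rp] := cseqP p; apply: (clim_uniq (rp y)).
by apply: clim_eq (rp y'); exists 0%N => n _; rewrite yy.
Qed.

Let cact1 p : cact 1%g p = p.
Proof.
apply: val_inj; apply/funext => y /=; apply: cmpl_ext => x.
by rewrite invg1 act1.
Qed.

Let cactM g h p : cact (g * h)%g p = cact g (cact h p).
Proof.
apply: val_inj; apply/funext => y /=; apply: cmpl_ext => x.
by rewrite invMg actM.
Qed.

Let cact_dot g (p q : hcmpl) : hdot (cact g p) (cact g q) = hdot p q.
Proof.
have rp := cseqP p; have rq := cseqP q.
have rgp : represents s _ (cmpl_fun (cact g p)) := act_repr g rp.
have rgq : represents s _ (cmpl_fun (cact g q)) := act_repr g rq.
apply: (clim_uniq (cdotE rgp rgq)); apply: clim_eq (cdotE rp rq).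
by exists 0%N => n _; rewrite act_isom.
Qed.

Lemma completion_rep : exists (T : unitary_rep K G) (i : E -> T),
  [/\ (forall a x y, i (a *: x + y) = a *: i x + i y),
      (forall x y, hdot (i x) (i y) = s x y),
      (forall (v : T) e, 0 < e -> exists x, `|v - i x| < e)
    & forall g x, rep_act T g (i x) = i (act g x)].
Proof.
exists (@UnitaryRep K G hcmpl (fun g => cact g) cact1 cactM cact_dot), hi; split.
- exact: cmpl_injP.
- exact: hdot_hi.
- exact: hi_dense.
- by move=> g x; apply: val_inj; apply/funext => y /=; rewrite act_adj.
Qed.

End CompletionRepresentation.

Section ComplexSequences.
Variable R : realType.
Local Notation C := R[i].
Local Open Scope complex_scope.

Let R_complete (u : nat -> R) :
  (forall e, 0 < e -> exists N, forall m n, (N <= m)%N -> (N <= n)%N ->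
     `|u m - u n| < e) ->
  exists l, forall e, 0 < e -> exists N, forall n, (N <= n)%N -> `|u n - l| < e.
Proof.
move=> uc; have : cvg (u @ \oo).
  apply/cauchy_cvgP/cauchyP => e /uc[N hN]; exists (u N).
  by exists N => // n /= Nn; apply: hN.
move=> /cvgrPdist_lt ul; exists (lim (u @ \oo)) => e /ul[N _ hN].
by exists N => n Nn; rewrite distrC; apply: hN.
Qed.

Let norm_real (x : R) : `|x%:C| = `|x|%:C :> C.
Proof. by rewrite normc_def /= expr0n addr0 sqrtr_sqr. Qed.

Let normi : `|'i : C| = 1.
Proof. by rewrite normc_def /= expr0n add0r expr1n sqrtr1. Qed.

Let normc_ge_Im (z : C) : `|complex.Im z|%:C <= `|z|.
Proof.
have := normc_ge_Re (z * 'i); rewrite ReiNIm normrN => /le_trans -> //.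
by rewrite normrM normi mulr1.
Qed.

Let normc_le_ReIm (z : C) : `|z| <= (`|complex.Re z| + `|complex.Im z|)%:C.
Proof.
rewrite {1}(complexE z) (le_trans (ler_normD _ _))// normrM !norm_real normi.
by rewrite mul1r rmorphD.
Qed.

Let gt0_Re (e : C) : 0 < e -> 0 < complex.Re e /\ e = (complex.Re e)%:C.
Proof.
move=> e0; have eR : e = (complex.Re e)%:C by rewrite RRe_real// gtr0_real.
by split => //; rewrite -ltcR -eR.
Qed.

Lemma complex_seq_complete (u : nat -> C) :
  (forall e, 0 < e -> exists N, forall m n, (N <= m)%N -> (N <= n)%N ->
     `|u m - u n| < e) -> exists l, clim u l.
Proof.
move=> uc.
have [|a ha] := @R_complete (fun n => complex.Re (u n)).
  move=> e e0; have [|N hN] := uc e%:C; first by rewrite ltcR.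
  exists N => m n Nm Nn; rewrite -ltcR (le_lt_trans _ (hN m n Nm Nn))//.
  by rewrite (le_trans _ (normc_ge_Re _))// raddfB.
have [|b hb] := @R_complete (fun n => complex.Im (u n)).
  move=> e e0; have [|N hN] := uc e%:C; first by rewrite ltcR.
  exists N => m n Nm Nn; rewrite -ltcR (le_lt_trans _ (hN m n Nm Nn))//.
  by rewrite (le_trans _ (normc_ge_Im _))// raddfB.
exists (a +i* b) => e /gt0_Re[e0 ->].
have e20 : 0 < complex.Re e / 2 by rewrite divr_gt0.
have [N hN] := ha _ e20; have [M hM] := hb _ e20.
exists (maxn N M) => n; rewrite geq_max => /andP[Nn Mn].
rewrite (le_lt_trans (normc_le_ReIm _))// ltcR [ltRHS]splitr.
have := hN _ Nn; have := hM _ Mn; case: (u n) => x y /= h1 h2.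
exact: ltrD.
Qed.

Lemma complex_seq_arch (e : C) : 0 < e ->
  exists N, forall n, (N <= n)%N -> n.+1%:R^-1 < e.
Proof.
move=> /gt0_Re[e0 ->]; have [k] := ltr_add_invr e0; rewrite add0r => ke.
exists k => n kn; rewrite -(rmorph_nat (real_complex R)) -fmorphV ltcR.
by rewrite (le_lt_trans _ ke)// lef_pV2 ?posrE// ler_nat.
Qed.

End ComplexSequences.

Section PermutationLemmas.

Lemma ext_permM n (s t : 'S_n) : ext_perm (s * t)%g = (ext_perm s * ext_perm t)%g.
Proof. exact/sinf_inj/ext_funM. Qed.

Lemma ext_perm1 n : ext_perm (1%g : 'S_n) = 1%g.
Proof. exact/sinf_inj/ext_fun1. Qed.

Lemma ext_permE n (s : 'S_n) (i : 'I_n) : ext_perm s i = s i.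
Proof. by rewrite /= /ext_fun valK. Qed.

Lemma ext_perm_out n (s : 'S_n) i : (n <= i)%N -> ext_perm s i = i.
Proof. by move=> ni; rewrite /= /ext_fun insubN// -leqNgt. Qed.

Lemma ext_perm_inj n : injective (@ext_perm n).
Proof.
move=> s t st; apply/permP => i; apply: val_inj; rewrite /= -!ext_permE.
by rewrite st.
Qed.

Lemma ext_perm_lift n (s : 'S_n) : ext_perm (lift_perm ord_max ord_max s) = ext_perm s.
Proof.
apply: sinf_inj => i; have [ni|iltn] := leqP n i.
  rewrite [RHS]ext_perm_out//; move: ni; rewrite leq_eqVlt => /predU1P[<-|ni].
    by rewrite (ext_permE _ (@ord_max n)) lift_perm_id.
  by rewrite ext_perm_out.
rewrite (ext_permE _ (Ordinal iltn)) -[i in LHS](lift_max (Ordinal iltn)) ext_permE.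
by rewrite lift_perm_lift lift_max.
Qed.

Lemma ext_perm_surj (g : Sinf) :
  exists N, forall n, (N <= n)%N -> exists t : 'S_n, ext_perm t = g.
Proof.
have [N gN] := sinf_fin g; exists N => n Nn.
have ginj := bij_inj (sinf_bij g).
have glt (i : 'I_n) : (g i < n)%N.
  rewrite ltnNge; apply/negP => ni.
  have /ginj gi := gN _ (leq_trans Nn ni).
  by have := ltn_ord i; rewrite ltnNge -{1}gi ni.
have tinj : injective (fun i : 'I_n => Ordinal (glt i)).
  by move=> i j /(congr1 val) /= /ginj /val_inj.
exists (perm tinj); apply: sinf_inj => i; have [ni|iltn] := leqP n i.
  by rewrite ext_perm_out// gN// (leq_trans Nn).
by rewrite (ext_permE _ (Ordinal iltn)) permE.
Qed.

Definition restr n (g : Sinf) : 'S_n :=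
  if pselect (exists t : 'S_n, ext_perm t = g) is left h then projT1 (cid h) else 1%g.

Lemma restrK n (t : 'S_n) : restr n (ext_perm t) = t.
Proof.
rewrite /restr; case: pselect => [h|[]]; last by exists t.
by case: cid => t' /= /ext_perm_inj.
Qed.

Lemma restrS n (t : 'S_n) : restr n.+1 (ext_perm t) = lift_perm ord_max ord_max t.
Proof. by rewrite -ext_perm_lift restrK. Qed.

Definition cojoin n (y : 'S_n) (k : 'I_n.+1) : 'S_n.+1 :=
  (lift_perm ord_max ord_max y * tperm ord_max k)%g.

Lemma cojoin_max n (y : 'S_n) k : cojoin y k ord_max = k.
Proof. by rewrite permM lift_perm_id tpermL. Qed.

Lemma lift_cproj n (x : 'S_n.+1) (i : 'I_n) : lift ord_max (cproj x i) =
  if x (lift ord_max i) == ord_max then x ord_max else x (lift ord_max i).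
Proof. by rewrite permE lift_cproj_fun. Qed.

Lemma cojoin_cproj n (x : 'S_n.+1) : cojoin (cproj x) (x ord_max) = x.
Proof.
apply/permP => i; case: (unliftP ord_max i) => [j ->|->]; last exact: cojoin_max.
rewrite permM lift_perm_lift lift_cproj; case: ifPn => [/eqP xj|xj].
  by rewrite tpermR xj.
by rewrite tpermD// 1?eq_sym// (inj_eq perm_inj) lift_eqF.
Qed.

Lemma cproj_cojoin n (y : 'S_n) k : cproj (cojoin y k) = y.
Proof.
apply/permP => i; apply: (@lift_inj _ ord_max); rewrite lift_cproj cojoin_max.
rewrite permM lift_perm_lift; case: tpermP => [/eqP|->|/eqP m /eqP k'].
- by rewrite lift_eqF.
- by rewrite eqxx.
- by rewrite lift_eqF.
Qed.

Lemma cproj_mul n (g h : 'S_n) (x : 'S_n.+1) :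
  cproj (lift_perm ord_max ord_max g * x * lift_perm ord_max ord_max h)%g
  = (g * cproj x * h)%g.
Proof.
apply/permP => i; apply: (@lift_inj _ ord_max); rewrite lift_cproj !permM.
rewrite lift_perm_lift lift_perm_id -(lift_perm_lift ord_max ord_max h).
rewrite lift_cproj -[in LHS](inj_eq (@perm_inj _ (lift_perm ord_max ord_max h)^-1)).
rewrite permK lift_permV lift_perm_id.
by case: ifP.
Qed.

End PermutationLemmas.

Section GeneralizedRegularExistence.
Variable R : realType.
Local Notation C := R[i].
Variable z : C.

Lemma Lz_linear n : linear (@Lz R z n).
Proof.
move=> a f g; apply/ffunP => x; rewrite !ffunE.
set c := _ * sqrtC _; rewrite mulrDr; congr (_ + _).
by rewrite -!/(_ * _) mulrCA.
Qed.

Lemma Reg_linear n g : linear (@Reg R n g).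
Proof. by move=> a f h; apply/ffunP => x; rewrite !ffunE. Qed.

Lemma dotnP n (a : C) (f g h : Hn R n) :
  dotn (a *: f + g) h = a * dotn f h + dotn g h.
Proof.
rewrite /dotn mulrCA -mulrDr; congr (_ * _); rewrite mulr_sumr -big_split /=.
by apply: eq_bigr => x _; rewrite !ffunE mulrDl mulrA.
Qed.

Lemma dotnC n (f g : Hn R n) : dotn f g = (dotn g f)^*.
Proof.
rewrite /dotn rmorphM /= fmorphV /= conjC_nat rmorph_sum; congr (_ * _).
by apply: eq_bigr => x _; rewrite rmorphM /= conjCK mulrC.
Qed.

Lemma dotn_ge0 n (f : Hn R n) : 0 <= dotn f f.
Proof.
rewrite /dotn mulr_ge0 ?invr_ge0 ?ler0n// sumr_ge0// => x _.
by rewrite -normCK exprn_ge0.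
Qed.

Lemma Reg_dot n g (f h : Hn R n) : dotn (Reg g f) h = dotn f (Reg (g.1^-1, g.2^-1)%g h).
Proof.
congr (_ * _).
rewrite (reindex_inj (mulgI g.2)) (reindex_inj (mulIg g.1^-1%g)) /=.
by apply: eq_bigr => x _; rewrite !ffunE /= invgK !mulgA mulVg mul1g mulgKV.
Qed.

Lemma Lz_isometry n (f g : Hn R n) : (0 < n)%N -> dotn (Lz z f) (Lz z g) = dotn f g.
Proof.
move=> n0; set d : C := `|z| ^+ 2 + n%:R.
have d0 : d != 0.
  by rewrite gt_eqF// ltr_wpDl ?exprn_ge0// ltr0n.
pose c := sqrtC (n.+1%:R / d); have c2 : n.+1%:R / d = c * c^*.
  rewrite /c -normCK ger0_norm ?sqrtCK// sqrtC_ge0 divr_ge0 ?ler0n// addr_ge0//.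
  by rewrite exprn_ge0.
have nn : (n.+1)%:R != 0 :> C by rewrite pnatr_eq0.
rewrite /dotn factS natrM invfM.
rewrite (reindex (fun p : 'I_n.+1 * 'S_n => cojoin p.2 p.1)) /=; last first.
  exists (fun x : 'S_n.+1 => (x ord_max, cproj x)) => [[k y] _|x _] /=.
    by rewrite cojoin_max cproj_cojoin.
  by rewrite cojoin_cproj.
rewrite -(pair_bigA _ (fun k y => Lz z f (cojoin y k) * (Lz z g (cojoin y k))^*)) /=.
pose S := \sum_y f y * (g y)^*.
have -> : \sum_(k < n.+1) \sum_y Lz z f (cojoin y k) * (Lz z g (cojoin y k))^*
  = \sum_(k < n.+1) (if k == ord_max then `|z| ^+ 2 else 1) * (n.+1%:R / d * S).
  apply: eq_bigr => k _; rewrite /S !mulr_sumr; apply: eq_bigr => y _.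
  rewrite !ffunE cojoin_max cproj_cojoin !rmorphM /= -/d -/c c2.
  case: ifP => _; rewrite ?normCK ?rmorph1; ring.
rewrite -mulr_suml big_ord_recr /= eqxx.
under eq_bigr => i _.
  rewrite (_ : widen_ord _ i == ord_max = false); last first.
    by rewrite -val_eqE /= ltn_eqF.
  over.
rewrite sumr_const card_ord -/S addrC -/d.
by field; rewrite -mulrS nn d0 pnatr_eq0 -lt0n fact_gt0.
Qed.

Lemma Lz_Reg n (g : 'S_n * 'S_n) (f : Hn R n) :
  Lz z (Reg g f) =
  Reg (lift_perm ord_max ord_max g.1, lift_perm ord_max ord_max g.2) (Lz z f).
Proof.
apply/ffunP => x; rewrite !ffunE /= lift_permV cproj_mul; congr (_ * _ * _).
rewrite !permM lift_perm_id.
rewrite -[in RHS](inj_eq (@perm_inj _ (lift_perm ord_max ord_max g.1)^-1%g)).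
by rewrite permK lift_permV lift_perm_id.
Qed.

Let X := {n & 'S_n}.
Let at_ (u : X -> C^o) n : Hn R n := [ffun x : 'S_n => u (existT _ n x)].

Let at_P n a u v : at_ (a *: u + v) n = a *: at_ u n + at_ v n.
Proof. by apply/ffunP => x; rewrite !ffunE. Qed.

Let Epred : {pred X -> C^o} :=
  fun u => `[< \forall n \near \oo, at_ u n.+1 = Lz z (at_ u n) >].

Let E_submod : submod_closed Epred.
Proof.
split=> [|a u v /asboolP hu /asboolP hv].
  apply/asboolP; near=> n; apply/ffunP => x; rewrite !ffunE /=.
  by rewrite mulr0.
apply/asboolP; near=> n; rewrite !at_P Lz_linear.
by rewrite (near hu n)// (near hv n).
Unshelve. all: by end_near. Qed.

Record Etype := EType { Efun : X -> C^o ; _ : Efun \in Epred }.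
HB.instance Definition _ := [isSub for Efun].
HB.instance Definition _ := [Choice of Etype by <:].
HB.instance Definition _ :=
  GRing.SubChoice_isSubLmodule.Build C (X -> C^o) Epred Etype E_submod.

Let at_E (u : Etype) n := at_ (Efun u) n.

Let at_EP a u v n : at_E (a *: u + v) n = a *: at_E u n + at_E v n.
Proof. by rewrite /at_E -at_P; have /= -> := linearP (val : Etype -> (X -> C^o)) a u v. Qed.

Let EP (u : Etype) : \forall n \near \oo, at_E u n.+1 = Lz z (at_E u n).
Proof. exact/asboolP/(valP u). Qed.

Let near_gt0 : \forall n \near \oo, (0 < n)%N.
Proof. by exists 1%N. Qed.

Let Es_ex (u v : Etype) : exists c, \forall n \near \oo, dotn (at_E u n) (at_E v n) = c.
Proof.
have [N _ hN] := filterI near_gt0 (filterI (EP u) (EP v)).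
exists (dotn (at_E u N) (at_E v N)); exists N => // n /= /subnK <-.
elim: (n - N)%N => [//|k <-]; rewrite addSn.
by have [k0 [-> ->]] := hN (k + N)%N (leq_addl _ _); rewrite Lz_isometry.
Qed.

Let Es u v : C := projT1 (cid (Es_ex u v)).
Let EsP u v : \forall n \near \oo, dotn (at_E u n) (at_E v n) = Es u v.
Proof. by rewrite /Es; case: cid. Qed.

Let near_eq (a b : C) : (\forall n \near \oo, a = b) -> a = b.
Proof. by move=> [N _ h]; apply: (h N) => /=. Qed.

Let Es_lin a x y w : Es (a *: x + y) w = a * Es x w + Es y w.
Proof.
apply: near_eq; have h1 := EsP (a *: x + y) w; have h2 := EsP x w; have h3 := EsP y w.
near=> n; rewrite -(near h1 n)// -(near h2 n)// -(near h3 n)//.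
by rewrite at_EP dotnP.
Unshelve. all: by end_near. Qed.

Let Es_conj x y : Es x y = (Es y x)^*.
Proof.
apply: near_eq; have h1 := EsP x y; have h2 := EsP y x.
by near=> n; rewrite -(near h1 n)// -(near h2 n)// -dotnC.
Unshelve. all: by end_near. Qed.

Let Es_ge0 x : 0 <= Es x x.
Proof. by have [N _ /(_ N (leqnn _)) <-] := EsP x x; apply: dotn_ge0. Qed.

Let restr_near (g : Sinf) : \forall n \near \oo, ext_perm (restr n g) = g.
Proof.
have [N hN] := ext_perm_surj g; exists N => // n /= /hN[t <-].
by rewrite restrK.
Qed.

Let gr n (g : Sinf2) := (restr n g.1, restr n g.2).

Let actf (g : Sinf2) (u : Etype) : X -> C^o :=
  fun p => Reg (gr (tag p) g) (at_E u (tag p)) (tagged p).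

Let at_actf g u n : at_ (actf g u) n = Reg (gr n g) (at_E u n).
Proof. by apply/ffunP => x; rewrite ffunE. Qed.

Let actf_in g u : actf g u \in Epred.
Proof.
have h1 := restr_near g.1; have h2 := restr_near g.2; have h3 := EP u.
apply/asboolP; near=> n; rewrite !at_actf (near h3 n)// Lz_Reg /=.
have -> : gr n.+1 g = (lift_perm ord_max ord_max (restr n g.1),
                       lift_perm ord_max ord_max (restr n g.2)).
  rewrite /gr -restrS -restrS; congr (restr _ _, restr _ _).
    by rewrite (near h1 n).
  by rewrite (near h2 n).
by [].
Unshelve. all: by end_near. Qed.

Let Eact g u : Etype := EType (actf_in g u).
Let at_Eact g u n : at_E (Eact g u) n = Reg (gr n g) (at_E u n).
Proof. exact: at_actf. Qed.

Let Es_ext x y y' : (\forall n \near \oo, at_E y n = at_E y' n) -> Es x y = Es x y'.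
Proof.
move=> yy; apply: near_eq; have h1 := EsP x y; have h2 := EsP x y'.
by near=> n; rewrite -(near h1 n)// -(near h2 n)// (near yy n).
Unshelve. all: by end_near. Qed.

Let RegM n (g h : 'S_n * 'S_n) (f : Hn R n) :
  Reg (g.1 * h.1, g.2 * h.2)%g f = Reg g (Reg h f).
Proof. by apply/ffunP => x; rewrite !ffunE /= invMg !mulgA. Qed.

Let Eact1 x y : Es x (Eact 1%g y) = Es x y.
Proof.
apply: Es_ext; near=> n; rewrite at_Eact /gr /= -(ext_perm1 n) restrK.
by apply/ffunP => w; rewrite ffunE /= invg1 mul1g mulg1.
Unshelve. all: by end_near. Qed.

Let EactM g h x y : Es x (Eact (g * h)%g y) = Es x (Eact g (Eact h y)).
Proof.
apply: Es_ext; have h1 := restr_near g.1; have h2 := restr_near g.2.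
have h3 := restr_near h.1; have h4 := restr_near h.2.
near=> n; rewrite !at_Eact -RegM; congr Reg; rewrite /gr /=.
rewrite -{1}(near h1 n)// -{1}(near h2 n)// -{1}(near h3 n)// -{1}(near h4 n)//.
by rewrite -!ext_permM !restrK.
Unshelve. all: by end_near. Qed.

Let Eact_adj g x y : Es (Eact g x) y = Es x (Eact g^-1%g y).
Proof.
apply: near_eq; have h1 := EsP (Eact g x) y; have h2 := EsP x (Eact g^-1%g y).
have h3 := restr_near g.1; have h4 := restr_near g.2.
near=> n; rewrite -(near h1 n)// -(near h2 n)// !at_Eact Reg_dot; congr (dotn _ (Reg _ _)).
have ext_permV (t : 'S_n) : (ext_perm t)^-1%g = ext_perm t^-1%g.
  by apply: (mulgI (ext_perm t)); rewrite mulgV -ext_permM mulgV ext_perm1.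
rewrite /gr /=; congr pair.
  by rewrite -[in RHS](near h3 n)// ext_permV restrK.
by rewrite -[in RHS](near h4 n)// ext_permV restrK.
Unshelve. all: by end_near. Qed.

Let castH n m (f : Hn R n) : Hn R m :=
  [ffun x : 'S_m => (if pselect (m = n) is left e then f (cast_perm e x) else 0) : C].

Let castHE n (f : Hn R n) : castH n f = f.
Proof.
apply/ffunP => x; rewrite ffunE; case: pselect => // e.
by rewrite (eq_irrelevance e erefl) cast_perm_id.
Qed.

Fixpoint up n (f : Hn R n) (m : nat) : Hn R m :=
  match m with
  | 0 => castH 0 f
  | m'.+1 => if (m' < n)%N then castH m'.+1 f else Lz z (up f m')
  end.

Let up_id n (f : Hn R n) : up f n = f.
Proof. by case: n f => [|n] f /=; rewrite ?ltnS ?leqnn castHE. Qed.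

Let upS n (f : Hn R n) m : (n <= m)%N -> up f m.+1 = Lz z (up f m).
Proof. by move=> nm; rewrite /= ltnNge nm. Qed.

Let up_linear n m a (f g : Hn R n) : up (a *: f + g) m = a *: up f m + up g m.
Proof.
have hc k : castH k (a *: f + g) = a *: castH k f + castH k g.
  apply/ffunP => x; rewrite !ffunE; case: pselect => // e; rewrite ?ffunE//.
  by rewrite addr0 [_ *: _]mulr0.
elim: m => [|m IH] /=; first exact: hc.
by case: ifP => _; rewrite ?hc// IH Lz_linear.
Qed.

Let seqf n (f : Hn R n) : X -> C^o := fun p => up f (tag p) (tagged p).
Let at_seqf n (f : Hn R n) m : at_ (seqf f) m = up f m.
Proof. by apply/ffunP => x; rewrite ffunE. Qed.

Let seqf_in n (f : Hn R n) : seqf f \in Epred.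
Proof. by apply/asboolP; exists n => // m /= nm; rewrite !at_seqf upS. Qed.
Let seqE n (f : Hn R n) : Etype := EType (seqf_in f).
Let at_seqE n (f : Hn R n) m : at_E (seqE f) m = up f m.
Proof. exact: at_seqf. Qed.

Let up_dot n (f g : Hn R n) m : (0 < n)%N -> (n <= m)%N -> dotn (up f m) (up g m) = dotn f g.
Proof.
move=> n0 /subnK <-; elim: (m - n)%N => [|k <-]; first by rewrite !up_id.
by rewrite addSn !upS ?leq_addl// Lz_isometry// (leq_trans n0)// leq_addl.
Qed.

Lemma generalized_regular_exists :
  exists T : unitary_rep C Sinf2, is_generalized_regular z T.
Proof.
have [T [i [iP idot idense iact]]] := completion_rep (@complex_seq_complete R)
  (@complex_seq_arch R) Es_lin Es_conj Es_ge0 Eact1 EactM Eact_adj.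
have i_eq x y : (\forall n \near \oo, at_E x n = at_E y n) -> i x = i y.
  move=> xy; apply/eqP; rewrite -subr_eq0 addrC -scaleN1r -iP -normr_eq0.
  rewrite -sqrf_eq0 hdot_norm idot; apply/eqP/near_eq.
  have h := EsP (-1 *: y + x) (-1 *: y + x).
  near=> n; rewrite -(near h n)// at_EP (near xy n)// scaleN1r addNr.
  by rewrite -[X in dotn X _](scale0r (0 : Hn R n)) -[_ *: _]addr0 dotnP mul0r add0r
    /dotn big1 ?mulr0// => ? _; rewrite ffunE mul0r.
exists T, (fun n f => i (seqE f)); split.
- move=> n n0; split=> [a f g|f g|f].
  + rewrite -iP; apply: i_eq; near=> m; rewrite at_EP !at_seqE.
    exact: up_linear.
  + rewrite idot; apply: near_eq; have h := EsP (seqE f) (seqE g).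
    near=> m; rewrite -(near h m)// !at_seqE up_dot//.
    by near: m; exists n.
  + apply: i_eq; exists n.+1 => // m /= /subnK <-; rewrite !at_seqE.
    elim: (m - n.+1)%N => [|k IH]; first by rewrite up_id upS// up_id.
    by rewrite addSn !upS ?IH ?leq_addl// (leq_trans (leqnSn n))// leq_addl.
- apply/seteqP; split=> // v _ B /nbhs_ballP[e /= e0 eB].
  have [x xv] := idense v e e0; exists (i x); split; last first.
    by apply: eB; rewrite -ball_normE.
  have [N _ hN] := filterI near_gt0 (EP x).
  exists N; split; first by have [] := hN N (leqnn _).
  exists (at_E x N) => //; apply: i_eq; exists N => // m /= /subnK <-.
  rewrite at_seqE; elim: (m - N)%N => [|k IH]; first by rewrite up_id.
  rewrite addSn upS ?leq_addl// IH.
  by have [_ ->] := hN (k + N)%N (leq_addl _ _).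
- move=> n g f n0; rewrite iact; apply: i_eq.
  exists n => // m /= nm; rewrite at_Eact !at_seqE.
  move: nm => /subnK <-; elim: (m - n)%N => [|k IH].
    by rewrite !up_id /gr /= !restrK; case: g.
  rewrite addSn !upS ?leq_addl// -IH Lz_Reg; congr Reg.
  have lift_restr (t : 'S_n) : restr (k + n).+1 (ext_perm t)
      = lift_perm ord_max ord_max (restr (k + n) (ext_perm t)).
    have [t' <-] : exists t' : 'S_(k + n), ext_perm t' = ext_perm t.
      elim: k {IH} => [|l [t' <-]]; first by exists t.
      by exists (lift_perm ord_max ord_max t'); exact: ext_perm_lift.
    by rewrite restrS restrK.
  by rewrite /gr /= !lift_restr.
Unshelve. all: by end_near. Qed.

End GeneralizedRegularExistence.

End Existence.

Lemma generalized_regular_exists (R : realType) (z : R[i]) :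
  exists T : unitary_rep R[i] Sinf2, is_generalized_regular z T.
Proof. exact: Existence.generalized_regular_exists. Qed.

(* Main.v *)
Require Import Defs.
From HB Require Import structures.
From mathcomp Require Import all_boot all_order all_fingroup all_algebra complex.
From mathcomp Require Import all_classical all_reals topology normedtype.
From mathcomp Require Import zify ring lra.

(** Write [X_k] for the Jucys-Murphy operator of right multiplication by the sum
    of the transpositions [(j k)], [j < k].  Since [cproj x] is [x] followed by
    the transposition of [ord_max] and [x ord_max], the isometry [Lz z] is, up to
    a scalar, extension by zero followed by [z + X_n] ([Lz_JM]).  Iterating, [T_z]
    sends [f] in [Hn n] to a multiple of the product of the [z + X_k],
    [n <= k < m], applied to [f] in [Hn m].

    Let [U] be an equivalence of subrepresentations of [T_z1] and [T_z2], extended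
    by the orthogonal projection [p].  The form [B f h = <U p (j1 f), j2 h>] on
    [Hn m] is bounded by [|f| |h|] and every [X_k] can be moved from one argument
    to the other, so in a joint eigenbasis of the [X_k] it only pairs vectors with
    the same eigenvalues [c].  Comparing with a third parameter [w],
    [B] of the lifts of [f] and [h] to level [m] is at most [|f| |h|] times the
    maximum over the joint spectrum of
    [|phi_z1 c| |phi_z2 c| / |phi_w c| ^ 2], where [phi_z c] is the eigenvalue of
    the lifting operator; here [|f|] and [|h|] come in because [Lz w] is itself an
    isometry ([intertwining_form_bound]).

    It remains to choose [w] so that this maximum tends to [0].  The scalar factors
    of the isometries have squares [(k + 1) / (|z| ^ 2 + k)], so if [|w| ^ 2] is
    smaller than the mean [T] of [|z1| ^ 2] and [|z2| ^ 2] by [e > 0], they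
    contribute about the product of the [1 - e / (T + k)], which tends to [0]
    because the harmonic series diverges.  The other factors stay bounded: with
    [Re w] the mean of [Re z1] and [Re z2], one has [|w + c| ^ 2 = A c - e] where
    [A c] is the mean of [|z1 + c| ^ 2] and [|z2 + c| ^ 2].  The arithmetic-geometric
    inequality [|z1 + c| |z2 + c| <= A c] is strict at [c = 0] or at [c = 1],
    since two points of the closed upper half-plane at equal distances from [0]
    and from [-1] coincide.  Each occurrence of that content therefore gains a
    factor less than [1], and this gain has to pay for replacing [A c] by
    [A c - e] at all contents.  It does for small [e]: the sum of [1 / A c]
    over the integers converges, and no content occurs much more often than [0]
    or [1] ([spectrum_values], [content_comparison]).

    The last fact says that the main diagonal of a Young diagram is a longest one
    and the diagonal next to it at most one box shorter.  It is derived from the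
    relations between the [X_k] and the Coxeter generators, as in the
    Okounkov-Vershik approach to the representations of the symmetric groups. *)

Set Implicit Arguments.
Unset Strict Implicit.
Unset Printing Implicit Defensive.
Import Order.TTheory GRing.Theory Num.Theory.
Import numFieldNormedType.Exports.
Local Open Scope ring_scope.

(** * Contents along the Young graph *)

Section ContentVectors.
Variable F : numDomainType.

Definition swap_at (i : nat) (c : nat -> F) (k : nat) : F :=
  if k == i then c i.+1 else if k == i.+1 then c i else c k.

(** What the degenerate affine Hecke and braid relations say about joint eigenvalues.  These
    closure properties already force the combinatorics of standard Young tableaux,
    so the rest of this part needs no representation theory. *)
Record content_family (m : nat) (S : (nat -> F) -> Prop) : Prop := {
  cf_start : forall c, S c -> (0 < m)%N -> c 0%N = 0 ;
  cf_neq : forall c i, S c -> (i.+1 < m)%N -> c i.+1 != c i ;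
  cf_swap : forall c i, S c -> (i.+1 < m)%N ->
    c i.+1 != c i + 1 -> c i.+1 != c i - 1 -> S (swap_at i c) ;
  cf_braid : forall c i (s : bool), S c -> (i.+2 < m)%N ->
    c i.+1 = c i + (-1) ^+ s -> c i.+2 != c i }.

Variables (m : nat) (S : (nat -> F) -> Prop).
Hypothesis Sfam : content_family m S.

(** If no earlier entry differs from [c q] by [1], then [c q] can be swapped
    leftwards until it comes next to the initial [0]; there it must be [0] itself
    as well as different from its neighbour. *)
Lemma content_neighbour c q : S c -> (0 < q < m)%N ->
  exists2 p, (p < q)%N & exists s : bool, c p = c q + (-1) ^+ s.
Proof.
elim: q c => [//|q IH] c Sc /= qm.
have [e|ne1] := eqVneq (c q.+1) (c q + 1).
  by exists q => //; exists true; rewrite e addrK.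
have [e|ne2] := eqVneq (c q.+1) (c q - 1).
  by exists q => //; exists false; rewrite e subrK.
have Sc' := cf_swap Sfam Sc qm ne1 ne2.
case: q => [|q] in IH qm ne1 ne2 Sc' *.
  have := cf_start Sfam Sc' (ltnW qm); rewrite /swap_at eqxx => c1.
  by have := cf_neq Sfam Sc qm; rewrite c1 (cf_start Sfam Sc (ltnW qm)) eqxx.
have [p pq [s]] := IH _ Sc' (ltnW qm).
rewrite /swap_at eqxx (ltn_eqF pq) (ltn_eqF (leqW pq)) => e.
by exists p; [exact: leqW|exists s].
Qed.

(** The hook condition: two equal entries enclose both neighbouring values.  The
    outer entries are swapped towards each other until this fails.  Then both inner
    neighbours equal [c p - (-1) ^+ s]; if they coincide, [cf_braid] is violated, and
    otherwise two applications of induction produce the missing value inside. *)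
Lemma content_between c p q (s : bool) : S c -> (p < q < m)%N -> c p = c q ->
  exists2 r, (p < r < q)%N & c r = c p + (-1) ^+ s.
Proof.
have [d] := ubnP (q - p); elim: d => [//|d IH] in c p q s * => pqd Sc /andP[pq qm] e.
case: q => [//|q] in pqd pq qm e *.
have pm := leq_ltn_trans pq qm.
move: pq; rewrite ltnS leq_eqVlt => /predU1P[pq|pq].
  by have := cf_neq Sfam Sc qm; rewrite -e pq eqxx.
have [cs|cns] := eqVneq (c q) (c p + (-1) ^+ s).
  by exists q => //; rewrite pq ltnSn.
have [cs'|cns'] := eqVneq (c q) (c p - (-1) ^+ s); last first.
  have [|||| r] := IH (swap_at q c) p q s.
  - by lia.
  - apply: (cf_swap Sfam Sc qm); rewrite -e; apply/eqP => h;
      move: cns cns'; rewrite h; case: s {IH} => /=;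
      by rewrite ?expr1 ?expr0 ?opprK ?addrK ?subrK ?eqxx.
  - by rewrite pq ltnW.
  - by rewrite /swap_at eqxx (ltn_eqF pq) (ltn_eqF (leqW pq)).
  move=> /andP[pr rq]; rewrite /swap_at !(ltn_eqF pq) !(ltn_eqF rq).
  rewrite (ltn_eqF (leqW rq)) (ltn_eqF (leqW pq)).
  by exists r => //; rewrite pr ltnW.
have [cs|cns''] := eqVneq (c p.+1) (c p + (-1) ^+ s).
  by exists p.+1 => //; rewrite ltnSn.
have [cs''|cns3] := eqVneq (c p.+1) (c p - (-1) ^+ s); last first.
  have [|||| r] := IH (swap_at p c) p.+1 q.+1 s.
  - by lia.
  - apply: (cf_swap Sfam Sc (leq_ltn_trans pq (ltnW qm))); apply/eqP => h;
      move: cns'' cns3; rewrite h; case: s {IH cns cs'} => /=;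
      by rewrite ?expr1 ?expr0 ?opprK ?addrK ?subrK ?eqxx.
  - by rewrite ltnS pq.
  - by rewrite /swap_at (gtn_eqF (ltnSn p)) eqxx (gtn_eqF (leqW pq)) eqSS (gtn_eqF pq).
  move=> /andP[pr rq]; rewrite /swap_at !(gtn_eqF pr) (gtn_eqF (ltnW pr)) eqxx.
  rewrite (gtn_eqF (ltnSn _)) => cr.
  by exists r => //; rewrite (ltnW pr).
move: (pq); rewrite leq_eqVlt => /predU1P[pq'|pq'].
  have := @cf_braid _ _ Sfam c p (~~ s) Sc; rewrite pq' => /(_ qm).
  by rewrite cs' e signrN eqxx => /(_ erefl).
(* Between these two equal entries lies the value [c p] again. *)
have [|||r /andP[pr rq]] := IH c p.+1 q s _ Sc.
- by lia.
- by rewrite pq' ltnW.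
- by rewrite cs' cs''.
rewrite cs'' subrK => cr.
have [||r' /andP[pr' rr'] cr'] := IH c p r s _ Sc _ (esym cr).
- by lia.
- by rewrite (ltn_trans _ pr)//= (ltn_trans rq)// ltnW.
by exists r' => //; rewrite pr' (ltn_trans rr')// leqW.
Qed.

Lemma content_integer c q : S c -> (q < m)%N ->
  exists2 z : int, c q = z%:~R & (`|z| <= q)%N.
Proof.
move=> Sc; have [d] := ubnP q; elim: d q => [//|d IH] q qd qm.
case: q => [|q] in qd qm *; first by exists 0 => //; rewrite (cf_start Sfam Sc).
have [|p pq [s e]] := @content_neighbour c q.+1 Sc; first exact: qm.
have [||z cz zp] := IH p; first exact: leq_trans pq _.
  exact: leq_trans (ltn_trans pq qm).
exists (z - (-1) ^+ s); first by rewrite rmorphB /= -cz e rmorph_sign addrK.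
by case: s {e} => /=; rewrite ?expr1 ?expr0; lia.
Qed.

(** The earlier neighbour given by [content_neighbour] may lie further from [0] than
    [c q]; induction then finds the value [c q] again before that neighbour, and the
    value closer to [0] earlier still. *)
Lemma content_below c q (s : bool) j : S c -> (q < m)%N ->
  c q = (-1) ^+ s * j.+1%:R -> exists2 p, (p < q)%N & c p = (-1) ^+ s * j%:R.
Proof.
move=> Sc; have [d] := ubnP q; elim: d q j => [//|d IH] q j qd qm cq.
have q0 : (0 < q)%N.
  rewrite lt0n; apply: contra_eq_neq cq => ->; rewrite (cf_start Sfam Sc)//.
    by rewrite eq_sym mulf_neq0 ?signr_eq0 ?pnatr_eq0.
  exact: leq_ltn_trans qm.
have [|p pq [s']] := @content_neighbour c q Sc; first by rewrite q0.
rewrite cq; have [-> cp|/negPf ns] := eqVneq s' (~~ s).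
  by exists p => //; rewrite cp signrN -[X in _ - X]mulr1 -mulrBr -natr1 addrK.
have {ns}-> : s' = s by case: s s' ns {IH cq} => -[].
move=> cp; have [|||p' pp' cp'] := IH p j.+1.
- exact: leq_trans pq _.
- exact: ltn_trans pq qm.
- by rewrite cp -[X in _ + X]mulr1 -mulrDr natr1.
have [||p'' pp'' cp''] := IH p' j _ _ cp'.
- exact: leq_trans (ltn_trans pp' pq) _.
- exact: ltn_trans (ltn_trans pp' pq) qm.
by exists p'' => //; apply: ltn_trans pp'' (ltn_trans pp' pq).
Qed.

Definition cnt (c : nat -> F) x n : nat := \sum_(k < n) (c k == x).

Lemma cntS c x n : cnt c x n.+1 = (cnt c x n + (c n == x))%N.
Proof. by rewrite /cnt big_ord_recr. Qed.

Lemma cnt_gt0 c x n : (0 < cnt c x n)%N -> exists2 k, (k < n)%N & c k = x.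
Proof.
elim: n => [|n IH]; first by rewrite /cnt big_ord0.
rewrite cntS; have [<- _|_] := eqVneq (c n) x; first by exists n.
by rewrite addn0 => /IH[k kn ck]; exists k => //; apply: leqW.
Qed.

Lemma last_occurrence (c : nat -> F) x n : (exists2 k, (k < n)%N & c k = x) ->
  exists2 k, (k < n)%N & c k = x /\ forall r, (k < r < n)%N -> c r <> x.
Proof.
elim: n => [[]//|n IH] [k kn ck]; have [e|/eqP ne] := eqVneq (c n) x.
  exists n => //; split=> // r /andP[nr]; rewrite ltnS => /(leq_trans nr).
  by rewrite ltnn.
have kn' : (k < n)%N.
  by move: kn; rewrite ltnS leq_eqVlt => /predU1P[kn|//]; rewrite -kn in ne.
have [|k' k'n [ck' h]] := IH; first by exists k.
exists k'; first exact: leqW.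
split=> // r /andP[kr]; rewrite ltnS leq_eqVlt => /predU1P[->//|rn].
by apply: h; rewrite kr.
Qed.

(** Interlacing: when a [y] separates any two occurrences of [x], the [x]s are at
    most one more than the [y]s, and not even one more if a [y] also comes before
    the first [x].  The induction carries the information that in case of equality
    every [y] has already been followed by an [x]. *)
Lemma cnt_interlace c x y (b : bool) n : x != y -> (n <= m)%N ->
  (forall k, (k < m)%N -> c k = x ->
     (exists2 r, (r < k)%N & c r = y /\ forall q, (r < q < k)%N -> c q <> x)
     \/ b /\ forall r, (r < k)%N -> c r <> x) ->
  (cnt c x n <= cnt c y n + b)%N.
Proof.
move=> xy nm h; suff [] : (cnt c x n <= cnt c y n + b)%N /\
  (cnt c x n = cnt c y n + b -> forall r, (r < n)%N -> c r = y ->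
   exists2 q, (r < q < n)%N & c q = x)%N by [].
elim: n nm => [|n IH] nm; first by rewrite /cnt !big_ord0.
have [IH1 IH2] := IH (ltnW nm); rewrite !cntS.
have [cx|cx] := eqVneq (c n) x.
  rewrite cx (negPf xy) addn0 addn1; split; last first.
    move=> _ r; rewrite ltnS leq_eqVlt => /predU1P[->|rn].
      by rewrite cx => e; rewrite e eqxx in xy.
    by exists n => //; rewrite rn ltnSn.
  case: (h n nm cx) => [[r rn [cr hr]]|[-> hn]].
    rewrite ltn_neqAle IH1 andbT; apply/negP => /eqP/IH2/(_ r rn cr)[q rqn].
    exact: hr.
  have [->|/cnt_gt0[k kn ck]] := posnP (cnt c x n); first by rewrite addn1.
  by have := hn k kn ck.
rewrite addn0; have [cy|cy] := eqVneq (c n) y.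
  rewrite addnAC addn1; split; first exact: leqW.
  by move=> e; move: IH1; rewrite e ltnn.
rewrite addn0; split=> // e r; rewrite ltnS leq_eqVlt => /predU1P[->|rn].
  by move=> cn; rewrite cn eqxx in cy.
move=> cr; have [q /andP[rq qn] cq] := IH2 e r rn cr.
by exists q => //; rewrite rq leqW.
Qed.

Lemma cnt_below c (s : bool) j : S c ->
  (cnt c ((-1) ^+ s * j.+1%:R)%R m <= cnt c ((-1) ^+ s * j%:R)%R m)%N.
Proof.
move=> Sc; rewrite -[leqRHS]addn0; apply: (@cnt_interlace _ _ _ false _ _ (leqnn m)).
  by rewrite (inj_eq (mulfI _)) ?signr_eq0// eqr_nat gtn_eqF.
move=> k km ck; left.
have [/last_occurrence[k' k'k [ck' hk']]|] :=
  pselect (exists2 k', (k' < k)%N & c k' = (-1) ^+ s * j.+1%:R); last first.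
  move=> nk; have [p pk cp] := content_below Sc km ck.
  exists p => //; split=> // q /andP[_ qk] cq.
  by apply: nk; exists q.
have [|r /andP[k'r rk] cr] := @content_between c k' k (~~ s) Sc _ (etrans ck' (esym ck)).
  by rewrite k'k.
exists r => //; split=> [|q /andP[rq qk]].
  by rewrite cr ck' signrN -[X in _ - X]mulr1 -mulrBr -natr1 addrK.
by apply: hk'; rewrite (ltn_trans k'r).
Qed.

Lemma cnt_0_1 c : S c -> (cnt c 0%R m <= (cnt c 1%R m).+1)%N.
Proof.
move=> Sc; rewrite -addn1; apply: (@cnt_interlace _ _ _ true _ _ (leqnn m)).
  by rewrite eq_sym oner_eq0.
move=> k km ck.
have [/last_occurrence[k' k'k [ck' hk']]|nk] :=
  pselect (exists2 k', (k' < k)%N & c k' = 0); last first.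
  by right; split=> // r rk cr; apply: nk; exists r.
left.
have [|r /andP[k'r rk] cr] := @content_between c k' k false Sc _ (etrans ck' (esym ck)).
  by rewrite k'k.
exists r => //; split=> [|q /andP[rq qk]]; first by rewrite cr ck' add0r.
by apply: hk'; rewrite (ltn_trans k'r).
Qed.

Lemma cnt_le_cnt0 c (z : int) : S c -> (cnt c z%:~R m <= cnt c 0%R m)%N.
Proof.
move=> Sc.
suff h (s : bool) j : (cnt c ((-1) ^+ s * j%:R)%R m <= cnt c 0%R m)%N.
  rewrite (_ : z%:~R = (-1) ^+ (z < 0)%R * `|z|%:R :> F); first exact: h.
  by rewrite {1}(intEsign z) rmorphM /= rmorph_sign.
elim: j => [|j IH]; first by rewrite mulr0.
exact: leq_trans (cnt_below _ _ _) IH.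
Qed.

End ContentVectors.

(** * Jucys-Murphy operators *)

(** A unitary matrix makes all members of the commuting family triangular, and a
    triangular hermitian matrix is diagonal. *)
Lemma hermitian_codiagonalization (K : numClosedFieldType) n (As : seq 'M[K]_n) :
  {in As &, forall A B, A *m B = B *m A} ->
  {in As, forall A, map_mx Num.conj A^T = A} ->
  exists2 P : 'M[K]_n, P *m map_mx Num.conj P^T = 1%:M &
    {in As, forall A, is_diag_mx (P *m A *m map_mx Num.conj P^T)}.
Proof.
move=> Acomm Aherm; have [P Pu /allP PA] := cotrigonalization Acomm.
exists P => [|A AAs]; first exact/unitarymxP.
have : is_trig_mx (conjmx P A) := PA A AAs; rewrite conjymx// => /is_trig_mxP trig.
apply/is_diag_mxP => i j; rewrite neq_ltn => /orP[/trig//|ji].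
have /(congr1 Num.conj) := trig _ _ ji; rewrite conjC0 => <-.
rewrite -[in LHS](Aherm A AAs) -[P as X in X *m _ *m _]trmxCK.
by rewrite -!map_mxM -!trmx_mul mulmxA 2!mxE.
Qed.

Section JucysMurphy.
Variables (R : realType) (m : nat).
Local Notation C := R[i].
Implicit Types (f g : Hn R m) (s t : 'S_m) (k : 'I_m).

Definition translate s f : Hn R m := Reg (s, 1%g) f.

Lemma translateE s f x : translate s f x = f (x * s)%g.
Proof. by rewrite ffunE /= invg1 mul1g. Qed.

Lemma translateM s t f : translate s (translate t f) = translate (s * t)%g f.
Proof. by apply/ffunP => x; rewrite !translateE mulgA. Qed.

HB.instance Definition _ s := GRing.isLinear.Build C (Hn R m) (Hn R m) _ (translate s)
  (@Existence.Reg_linear R m (s, 1%g)).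

Definition JM k f : Hn R m := \sum_(j < m | (j < k)%N) translate (tperm j k) f.

Lemma JM_linear k : linear (JM k).
Proof.
move=> a f g; rewrite /JM scaler_sumr -big_split; apply: eq_bigr => j _.
exact: linearP.
Qed.
HB.instance Definition _ k := GRing.isLinear.Build C (Hn R m) (Hn R m) _ (JM k)
  (JM_linear k).

Lemma JM_0 k f : k = 0%N :> nat -> JM k f = 0.
Proof. by rewrite /JM => ->; rewrite big_pred0_eq. Qed.

Lemma JM_translate s k f : s k = k -> (forall j : 'I_m, (s j < k)%N = (j < k)%N) ->
  JM k (translate s f) = translate s (JM k f).
Proof.
move=> sk slt; rewrite /JM linear_sum [RHS](reindex_inj (@perm_inj _ s)) /=.
apply: eq_big => [j|j _]; first by rewrite slt.
by rewrite !translateM -{2}sk -tpermJ conjgE !mulgA mulgV mul1g.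
Qed.

(** The transpositions making up the lower operator permute the points below the
    upper index and fix that index, so they commute with the upper operator. *)
Lemma JM_comm k l f : JM k (JM l f) = JM l (JM k f).
Proof.
wlog lk : k l / (l < k)%N => [th|].
  have [->//|kl] := eqVneq k l; have [lk|kl'] := ltnP l k; first exact: th.
  by apply/esym/th; rewrite ltn_neqAle kl.
rewrite {1 3}/JM [LHS](linear_sum (JM k)); apply: eq_bigr => j jl.
have jk := ltn_trans jl lk.
apply: JM_translate => [|i]; first by rewrite tpermD// -val_eqE /= ltn_eqF.
by case: tpermP => [->|->|]//; rewrite jk lk.
Qed.

Lemma JM_succ k k' f : k' = k.+1 :> nat ->
  JM k' f = translate (tperm k k') (JM k (translate (tperm k k') f)) + translate (tperm k k') f.
Proof.
move=> k'E; rewrite {1}/JM (bigD1 k) ?k'E//= addrC; congr (_ + _).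
rewrite /JM linear_sum; apply: eq_big => [j|j /andP[jk' jk]].
  by rewrite ltnS ltn_neqAle val_eqE andbC.
rewrite /= !translateM -{1}[tperm k k']tpermV -?mulgA -conjgE tpermJ tpermL tpermD//.
  by rewrite eq_sym.
by rewrite -val_eqE /= k'E gtn_eqF.
Qed.

Lemma dotnZD a f g h : dotn (a *: f + g) h = a * dotn f h + dotn g h.
Proof. exact: Existence.dotnP. Qed.

Lemma dotn_conj f g : dotn f g = (dotn g f)^*.
Proof. exact: Existence.dotnC. Qed.

Lemma dotnD f g h : dotn (f + g) h = dotn f h + dotn g h.
Proof. exact: (Existence.sD dotnZD). Qed.
Lemma dotnZ a f g : dotn (a *: f) g = a * dotn f g.
Proof. exact: (Existence.sZ dotnZD). Qed.
Lemma dotn0 g : dotn 0 g = 0.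
Proof. exact: (Existence.s0 dotnZD). Qed.
Lemma dotnZr a f g : dotn f (a *: g) = a^* * dotn f g.
Proof. exact: (Existence.sZr dotnZD dotn_conj). Qed.
Lemma dotn_suml I (r : seq I) (P : pred I) (F : I -> Hn R m) g :
  dotn (\sum_(i <- r | P i) F i) g = \sum_(i <- r | P i) dotn (F i) g.
Proof.
apply: (big_morph (fun f : Hn R m => dotn f g)) => [f h|]; first exact: dotnD.
exact: dotn0.
Qed.
Lemma dotn_sumr I (r : seq I) (P : pred I) (F : I -> Hn R m) g :
  dotn g (\sum_(i <- r | P i) F i) = \sum_(i <- r | P i) dotn g (F i).
Proof.
rewrite dotn_conj dotn_suml rmorph_sum; apply: eq_bigr => i _.
by rewrite [RHS]dotn_conj.
Qed.

Lemma dotn_eq0 f : (dotn f f == 0) = (f == 0).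
Proof.
apply/idP/eqP => [|->]; last by rewrite dotn0.
rewrite mulf_eq0 invr_eq0 pnatr_eq0 eqn0Ngt fact_gt0 /= psumr_eq0.
  move=> /allP f0; apply/ffunP => x; rewrite ffunE; apply/eqP.
  by have := f0 x (mem_index_enum _); rewrite -normCK sqrf_eq0 normr_eq0.
by move=> x _; rewrite -normCK exprn_ge0.
Qed.

Lemma translate_adj s f g : dotn (translate s f) g = dotn f (translate s^-1%g g).
Proof.
rewrite /translate Existence.Reg_dot /=; congr (dotn _ (Reg (_, _) _)); exact: invg1.
Qed.

Lemma JM_adj k f g : dotn (JM k f) g = dotn f (JM k g).
Proof.
rewrite dotn_suml dotn_sumr; apply: eq_bigr => j _.
by rewrite translate_adj tpermV.
Qed.

Definition joint_eigen (c : nat -> C) f : Prop := forall k, JM k f = c k *: f.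

Definition JM_spectrum (c : nat -> C) : Prop :=
  exists2 f, f != 0 & joint_eigen c f.

Lemma JM_eigen_real f k a : f != 0 -> JM k f = a *: f -> a^* = a.
Proof.
move=> f0 fk; have := JM_adj k f f; rewrite fk dotnZ dotnZr => e.
by apply: (@mulIf _ (dotn f f)); rewrite ?dotn_eq0.
Qed.

Lemma translate_tperm2 k k' f : translate (tperm k k') (translate (tperm k k') f) = f.
Proof. by rewrite translateM tperm2; apply/ffunP => x; rewrite translateE mulg1. Qed.

(** The Hecke relation: [X_(k+1) s = s X_k + 1] for the Coxeter generator [s]
    exchanging [k] and [k + 1]. *)
Lemma JM_transposition k k' f : k' = k.+1 :> nat ->
  JM k' (translate (tperm k k') f) = translate (tperm k k') (JM k f) + f.
Proof. by move=> k'E; rewrite (JM_succ _ k'E) !translate_tperm2. Qed.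

Lemma JM_transposition' k k' f : k' = k.+1 :> nat ->
  JM k (translate (tperm k k') f) = translate (tperm k k') (JM k' f) - f.
Proof.
by move=> k'E; rewrite (JM_succ _ k'E) linearD /= !translate_tperm2 addrK.
Qed.

End JucysMurphy.

(** * Joint spectrum of the Jucys-Murphy operators *)

Section Spectrum.
Variables (R : realType) (m : nat).
Local Notation C := R[i].
Implicit Types (f g : Hn R m) (c : nat -> C).

(** If the two eigenvalues were equal, moving [X_(k+1)] across [dotn (s f) f] would
    leave the extra term [dotn f f] of the Hecke relation equal to [0]. *)
Lemma joint_eigen_neq c f (k k' : 'I_m) : f != 0 -> joint_eigen c f ->
  k' = k.+1 :> nat -> c k' != c k.
Proof.
move=> f0 fc k'E; apply/eqP => e.
have := JM_adj k' (translate (tperm k k') f) f.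
rewrite (JM_transposition _ k'E) !fc linearZ /= dotnD dotnZ dotnZr.
rewrite (JM_eigen_real f0 (fc k')) -e -[RHS]addr0 => /addrI/eqP.
by rewrite dotn_eq0 (negPf f0).
Qed.

(** The intertwiner of the degenerate affine Hecke algebra: the Hecke relations make
    the correction by [(c k' - c k)^-1] the one that exchanges the eigenvalues. *)
Lemma joint_eigen_swap c f (k k' : 'I_m) : joint_eigen c f ->
  k' = k.+1 :> nat -> c k' != c k ->
  joint_eigen (swap_at k c) (translate (tperm k k') f - (c k' - c k)^-1 *: f).
Proof.
move=> fc k'E; rewrite -subr_eq0 => ne l.
rewrite linearB linearZ /= /swap_at.
have [lk|lk] := eqVneq (l : nat) k.
  have -> : l = k by apply: val_inj.
  rewrite (JM_transposition' _ k'E) !fc linearZ /= -k'E scalerBr !scalerA -addrA.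
  congr (_ + _); rewrite -opprD -[X in X + _]scale1r -scalerDl; congr (- (_ *: _)).
  by field.
have [lk'|lk'] := eqVneq (l : nat) k.+1.
  have -> : l = k' by apply: val_inj; rewrite /= lk' k'E.
  rewrite (JM_transposition _ k'E) !fc linearZ /= scalerBr !scalerA -addrA.
  congr (_ + _); rewrite -[X in X - _]scale1r -scalerBl -scaleNr; congr (_ *: _).
  by field.
rewrite JM_translate; first by rewrite fc linearZ /= scalerBr !scalerA [c l * _]mulrC.
  by rewrite tpermD// eq_sym -?k'E// -val_eqE /= k'E.
move=> j; case: tpermP => [->|->|//]; rewrite k'E; move: lk lk' => /eqP ? /eqP ?; lia.
Qed.

(** The vector [u = s f - e f], with [e] the sign, has eigenvalue [c k'] for [X_k],
    so it is orthogonal to [f]; as [s u = - e u], it is also orthogonal to [s f],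
    hence to itself. *)
Lemma joint_eigen_transposition c f (k k' : 'I_m) (s : bool) : joint_eigen c f ->
  k' = k.+1 :> nat -> c k' = c k + (-1) ^+ s ->
  translate (tperm k k') f = (-1) ^+ s *: f.
Proof.
move=> fc k'E e; have [->|f0] := eqVneq f 0; first by rewrite linear0 scaler0.
have ne := joint_eigen_neq f0 fc k'E.
have uc := joint_eigen_swap fc k'E ne; move: uc.
rewrite {1}e [c k + _]addrC addrK invr_sign; set u := _ - _ => uc.
have uf : dotn u f = 0.
  apply/eqP; have := JM_adj k u f; rewrite uc fc dotnZ dotnZr.
  rewrite (JM_eigen_real f0 (fc k)) /swap_at eqxx -k'E => /eqP.
  by rewrite -subr_eq0 -mulrBl mulf_eq0 subr_eq0 (negPf ne).
have suf : dotn (translate (tperm k k') u) f = 0.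
  rewrite /u linearB linearZ /= translate_tperm2.
  have -> : f - (-1) ^+ s *: translate (tperm k k') f = - ((-1) ^+ s *: u).
    by rewrite /u scalerBr scalerA -expr2 sqrr_sign scale1r opprB.
  by rewrite -scaleNr !dotnZ uf mulr0.
apply/eqP; rewrite -subr_eq0 -/u -dotn_eq0 {2}/u.
rewrite -scaleNr addrC dotn_conj dotnD dotnZ rmorphD rmorphM /= -!dotn_conj uf mulr0.
by rewrite add0r -[tperm k k']tpermV -translate_adj suf.
Qed.

Lemma JM_content_family : content_family m (@JM_spectrum R m).
Proof.
split.
- move=> c [f f0 fc] m0; apply/eqP.
  have := fc (Ordinal m0); rewrite JM_0//= => /esym/eqP.
  by rewrite scaler_eq0 (negPf f0) orbF.
- move=> c i [f f0 fc] im.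
  exact: (@joint_eigen_neq c f (Ordinal (ltnW im)) (Ordinal im)).
- move=> c i [f f0 fc] im ne1 ne2.
  set k := Ordinal (ltnW im); set k' := Ordinal im.
  have ne : c k' != c k by exact: joint_eigen_neq f0 fc _.
  exists (translate (tperm k k') f - (c k' - c k)^-1 *: f); last first.
    exact: joint_eigen_swap fc _ ne.
  rewrite subr_eq0; apply/eqP => e.
  have := congr1 (translate (tperm k k')) e; rewrite translate_tperm2 linearZ /= e scalerA.
  rewrite -{1}[f]scale1r => /eqP; rewrite -subr_eq0 -scalerBl scaler_eq0 (negPf f0).
  rewrite orbF subr_eq0 -expr2 eq_sym sqrf_eq1 => /orP[] /eqP e1.
    move: ne1; have -> : c i.+1 = c i + 1; last by rewrite eqxx.
    by rewrite -[1]invr1 -e1 invrK addrC subrK.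
  move: ne2; have -> : c i.+1 = c i - 1; last by rewrite eqxx.
  by rewrite -[1]invr1 -invrN -e1 invrK addrC subrK.
- move=> c i s [f f0 fc] im e1; apply/eqP => e2.
  pose k0 := Ordinal (ltnW (ltnW im)); pose k1 := Ordinal (ltnW im).
  pose k2 := Ordinal im.
  have h1 : translate (tperm k0 k1) f = (-1) ^+ s *: f.
    exact: (joint_eigen_transposition fc).
  have h2 : translate (tperm k1 k2) f = (-1) ^+ (~~ s) *: f.
    by apply: (joint_eigen_transposition fc) => //=; rewrite e2 e1 signrN addrK.
  have braid : (tperm k0 k1 * tperm k1 k2 * tperm k0 k1
              = tperm k1 k2 * tperm k0 k1 * tperm k1 k2)%g.
    have conj (a b : 'I_m) x : (tperm a b * x * tperm a b = x ^ tperm a b)%g.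
      by rewrite conjgE tpermV mulgA.
    by rewrite !conj !tpermJ tpermR tpermL !tpermD// -val_eqE /=; lia.
  have := congr1 (fun s => translate s f) braid; rewrite -!translateM !(h1, h2, linearZ) /=.
  rewrite !(h1, h2, linearZ) /= !(h1, h2, linearZ) /= signrN !scalerA.
  move/eqP; rewrite -subr_eq0 -scalerBl scaler_eq0 (negPf f0) orbF.
  case: s {e1 h1 h2}; rewrite ?expr1 ?expr0 !(mulr1, mulrN, opprK) -?opprD ?oppr_eq0.
    by rewrite (pnatr_eq0 _ 2).
  by rewrite (pnatr_eq0 _ 2).
Qed.

End Spectrum.

Section Eigenbasis.
Variables (R : realType) (m : nat).
Local Notation C := R[i].
Implicit Types (f g : Hn R m) (c : nat -> C).

(** The operators become commuting symmetric matrices with nonnegative integer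
    entries once [Hn m] is identified with row vectors. *)
Lemma JM_eigenbasis : exists N (v : 'I_N -> Hn R m) (chi : 'I_N -> nat -> C),
  [/\ forall i j, dotn (v i) (v j) = (i == j)%:R,
      forall f, f = \sum_i dotn f (v i) *: v i
    & forall i, joint_eigen (chi i) (v i)].
Proof.
pose T : finType := 'S_m; pose N := #|T|.
pose A (k : 'I_m) : 'M[C]_N := \matrix_(i, j)
  \sum_(l < m | (l < k)%N) (enum_val j * tperm l k == enum_val i :> 'S_m)%g%:R.
have JM_A k f (j : 'I_N) : JM k f (enum_val j) = \sum_i f (enum_val i) * A k i j.
  under eq_bigr do rewrite mxE mulr_sumr.
  rewrite exchange_big /JM sum_ffunE; apply: eq_bigr => l _ /=.
  rewrite translateE (bigD1 (enum_rank (enum_val j * tperm l k)%g : 'I_N)) //= enum_rankK.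
  rewrite eqxx mulr1 big1 ?addr0// => i ne.
  case: eqP => [e|]; last by rewrite mulr0.
  by move: ne; rewrite e enum_valK eqxx.
have A_herm k : map_mx Num.conj (A k)^T = A k.
  apply/matrixP => i j; rewrite !mxE rmorph_sum; apply: eq_bigr => l _ /=.
  rewrite conjC_nat; congr (_%:R : C); congr nat_of_bool.
  by rewrite -(can_eq (mulgK (tperm l k))) -mulgA tperm2 mulg1 eq_sym.
have A_comm k l : A k *m A l = A l *m A k.
  have row_A (k' l' : 'I_m) (i j : 'I_N) : (A k' *m A l') i j =
      JM l' (JM k' [ffun x => (x == enum_val i)%:R]) (enum_val j).
    rewrite mxE JM_A; apply: eq_bigr => i' _; rewrite JM_A; congr (_ * _).
    rewrite (bigD1 i)//= ffunE eqxx mul1r big1 ?addr0// => i'' ne.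
    by rewrite ffunE (inj_eq enum_val_inj) (negPf ne) mul0r.
  by apply/matrixP => i j; rewrite !row_A JM_comm.
have [|A' /mapP[k _ ->]//|P Pu PA] := @hermitian_codiagonalization _ N [seq A k | k : 'I_m].
  by move=> ? ? /mapP[k _ ->] /mapP[l _ ->].
have Pu' := mulmx1C Pu.
pose D k := P *m A k *m map_mx Num.conj P^T.
have D_diag k i j : i != j -> D k i j = 0.
  move: i j; apply/is_diag_mxP/PA; exact: map_f (mem_enum _ k).
have PAE k i j : (P *m A k) i j = D k i i * P i j.
  have -> : P *m A k = D k *m P by rewrite /D -mulmxA Pu' mulmx1.
  rewrite mxE (bigD1 i)//= big1 ?addr0// => i' ne.
  by rewrite D_diag 1?eq_sym// mul0r.
pose M : C := (m`!)%:R; pose c := sqrtC M.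
have M0 : M != 0 by rewrite pnatr_eq0 -lt0n fact_gt0.
have cc : c * c^* = M.
  by rewrite geC0_conj -?expr2 ?sqrtCK// sqrtC_ge0 ler0n.
pose v i : Hn R m := [ffun x => c * P i (enum_rank x)].
have sumT (F : 'S_m -> C) : \sum_x F x = \sum_(i < N) F (enum_val i).
  rewrite (reindex (@enum_val _ T)) /=; first exact: eq_bigl.
  by apply: onW_bij; exact: enum_val_bij.
exists N, v, (fun i n => if insub n is Some k then D k i i else 0); split.
- move=> i j; have := congr1 (fun A : 'M[C]_N => A i j) Pu; rewrite !mxE => <-.
  rewrite /dotn sumT mulr_sumr; apply: eq_bigr => l _.
  rewrite !ffunE !enum_valK rmorphM /= !mxE.
  by rewrite -/M -[RHS]mul1r -(mulVf M0) -cc; ring.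
- move=> f; apply/ffunP => x; rewrite -[x]enum_rankK; set j := enum_rank x.
  rewrite sum_ffunE.
  under eq_bigr => i _.
    rewrite /dotn sumT !ffunE enum_valK mulr_sumr [_ *: _]mulr_suml.
    under eq_bigr => l _.
      rewrite ffunE enum_valK rmorphM /=.
      rewrite (_ : M^-1 * (f (enum_val l) * (c^* * (P i l)^*)) * (c * P i j)
                 = f (enum_val l) * ((P i l)^* * P i j)); last first.
        by rewrite -[RHS]mul1r -(mulVf M0) -cc; ring.
      over.
    over.
  rewrite exchange_big (bigD1 j)//= -mulr_sumr.
  have e l : \sum_i (P i l)^* * P i j = (l == j)%:R.
    have := congr1 (fun A : 'M[C]_N => A l j) Pu'; rewrite !mxE => <-.
    by apply: eq_bigr => i _; rewrite !mxE.
  rewrite e eqxx mulr1 big1 ?addr0// => l ne.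
  by rewrite -mulr_sumr e (negPf ne) mulr0.
- move=> i k; apply/ffunP => x; rewrite -[x]enum_rankK; set j := enum_rank x.
  rewrite JM_A valK !ffunE enum_valK [_ *: _]mulrCA -PAE mxE mulr_sumr.
  by apply: eq_bigr => l _; rewrite ffunE enum_valK mulrA.
Qed.

End Eigenbasis.

(** * The isometries as products of shifted Jucys-Murphy operators *)

Section Lift.
Variable R : realType.
Local Notation C := R[i].

HB.instance Definition _ z n := GRing.isLinear.Build C (Hn R n) (Hn R n.+1) _
  (@Lz R z n) (@Existence.Lz_linear R z n).

Definition zero_ext n (f : Hn R n) : Hn R n.+1 :=
  [ffun x : 'S_n.+1 => if x ord_max == ord_max then f (cproj x) else 0].

Lemma zero_ext_linear n : linear (@zero_ext n).
Proof.
by move=> a f g; apply/ffunP => x; rewrite !ffunE; case: ifP => // _; rewrite scaler0 addr0.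
Qed.
HB.instance Definition _ n := GRing.isLinear.Build C (Hn R n) (Hn R n.+1) _
  (@zero_ext n) (@zero_ext_linear n).

(** The reason the Jucys-Murphy operators of all levels can be diagonalized at the
    highest one. *)
Lemma zero_ext_JM n (k : 'I_n) (f : Hn R n) :
  zero_ext (JM k f) = JM (lift ord_max k) (zero_ext f).
Proof.
apply/ffunP => x; rewrite ffunE /JM !sum_ffunE [RHS]big_mkcond [RHS]big_ord_recr /=.
rewrite [X in _ = _ + X]ifF ?addr0; last first.
  by have := lift_max k => /= ->; apply/negbTE; rewrite -leqNgt ltnW.
have -> : (if x ord_max == ord_max then
     \sum_(j < n | (j < k)%N) translate (tperm j k) f (cproj x) else 0)
  = \sum_(j < n | (j < k)%N)
      (if x ord_max == ord_max then translate (tperm j k) f (cproj x) else 0).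
  by case: ifP => // _; rewrite big1.
rewrite [LHS]big_mkcond; apply: eq_bigr => j _.
rewrite -[bump n k]/(nat_of_ord (lift ord_max k)) lift_max.
have -> : widen_ord (leqnSn n) j = lift ord_max j.
  by apply: val_inj; rewrite [RHS]lift_max.
case: ifP => // _; rewrite !translateE ffunE.
have -> : tperm (lift ord_max j) (lift ord_max k) = lift_perm ord_max ord_max (tperm j k).
  apply/permP => i; case: (unliftP ord_max i) => [i' ->|->].
    rewrite lift_perm_lift; case: (tpermP j k i') => [->|->|/eqP ij /eqP ik].
    - by rewrite tpermL.
    - by rewrite tpermR.
    - by rewrite tpermD// (inj_eq lift_inj) eq_sym.
  by rewrite lift_perm_id tpermD// lift_eqF.
have := Existence.cproj_mul 1%g (tperm j k) x; rewrite lift_perm1 !mul1g => ->.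
set t := lift_perm _ _ _; have tE y : (t y == ord_max) = (y == ord_max).
  by rewrite -[RHS](inj_eq (@perm_inj _ t)) lift_perm_id.
by rewrite permM tE.
Qed.

(** At [x] moving [ord_max], the only transposition [(j ord_max)] that brings [x]
    back into the smaller group is the one with [j = x ord_max], and it yields
    [cproj x]; at [x] fixing [ord_max] none does. *)
Lemma Lz_JM z n (f : Hn R n) :
  Lz z f = sqrtC (n.+1%:R / (`|z| ^+ 2 + n%:R)) *:
             (z *: zero_ext f + JM ord_max (zero_ext f)).
Proof.
apply/ffunP => x; rewrite !ffunE mulrC mulrA mulrC; congr (_ * _).
rewrite /JM sum_ffunE; have [xm|xm] := eqVneq (x ord_max) ord_max.
  rewrite big1 ?addr0 1?mulrC// => j jm; rewrite translateE ffunE permM xm tpermR.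
  by rewrite -val_eqE ltn_eqF.
rewrite [_ *: _]mulr0 add0r mulr1.
have xlt : (x ord_max < n)%N by rewrite ltn_neqAle -ltnS ltn_ord andbT.
rewrite (bigD1 (x ord_max))//= translateE ffunE permM tpermL eqxx big1 ?addr0; last first.
  move=> j /andP[jm jx]; rewrite translateE ffunE permM tpermD ?(negPf xm)//.
  by rewrite eq_sym.
congr (f _); apply/permP => i; apply: (@lift_inj _ ord_max).
rewrite !Existence.lift_cproj !permM tpermL.
have [xi|xi] := eqVneq (x (lift ord_max i)) ord_max.
  by rewrite xi tpermR (negPf xm).
rewrite tpermD ?(negPf xi)// 1?eq_sym//.
by rewrite (inj_eq perm_inj) lift_eqF.
Qed.

Fixpoint Lzn z n d (f : Hn R n) : Hn R (d + n) :=
  if d is d'.+1 then Lz z (Lzn z d' f) else f.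

Fixpoint zero_extn n d (f : Hn R n) : Hn R (d + n) :=
  if d is d'.+1 then zero_ext (zero_extn d' f) else f.

(** The points [n], ..., [d + n - 1], largest first, so that each level adds one
    factor on the left. *)
Fixpoint new_points n d : seq 'I_(d + n) :=
  if d is d'.+1 then ord_max :: map (lift ord_max) (new_points n d') else [::].

Definition JMprod z m (s : seq 'I_m) (f : Hn R m) : Hn R m :=
  foldr (fun k g => z *: g + JM k g) f s.

Definition Lz_scale (z : C) n d : C :=
  \prod_(i < d) sqrtC ((i + n).+1%:R / (`|z| ^+ 2 + (i + n)%:R)).

Lemma Lzn_JMprod z n d (f : Hn R n) :
  Lzn z d f = Lz_scale z n d *: JMprod z (new_points n d) (zero_extn d f).
Proof.
elim: d => [|d IH] /=; first by rewrite /Lz_scale big_ord0 scale1r.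
rewrite IH linearZ /= Lz_JM scalerA /Lz_scale big_ord_recr /=; congr (_ *: _).
suff -> : forall s g, zero_ext (JMprod z s g) = JMprod z (map (lift ord_max) s) (zero_ext g).
  by [].
move=> m s g; elim: s => //= k s IHs.
by rewrite linearD linearZ /= zero_ext_JM IHs.
Qed.

Lemma JMprod_dot z m (s : seq 'I_m) f v (c : nat -> C) : v != 0 ->
  joint_eigen c v -> dotn (JMprod z s f) v = \prod_(k <- s) (z + c k) * dotn f v.
Proof.
move=> v0 vc; elim: s => [|k s IH]; first by rewrite big_nil mul1r.
rewrite big_cons /= dotnD dotnZ JM_adj vc dotnZr (JM_eigen_real v0 (vc k)) IH.
by rewrite -mulrDl mulrA.
Qed.

Lemma prod_new_points (F : nat -> C) n d :
  \prod_(k <- new_points n d) F k = \prod_(i < d) F (i + n)%N.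
Proof.
elim: d => [|d IH]; first by rewrite big_nil big_ord0.
rewrite big_cons big_map big_ord_recr /= mulrC -IH; congr (_ * _).
by apply: eq_bigr => k _; rewrite -[bump _ _]/(nat_of_ord (lift ord_max k)) lift_max.
Qed.

(** In an eigenbasis the lift from level [n] acts by scalars. *)
Lemma Lzn_dot z n d (f : Hn R n) v (c : nat -> C) : v != 0 -> joint_eigen c v ->
  dotn (Lzn z d f) v =
  Lz_scale z n d * \prod_(i < d) (z + c (i + n)%N) * dotn (zero_extn d f) v.
Proof.
move=> v0 vc; rewrite Lzn_JMprod dotnZ (JMprod_dot _ _ _ v0 vc).
by rewrite (prod_new_points (fun k => z + c k)) mulrA.
Qed.

Lemma Lzn_isometry z n d (f g : Hn R n) : (0 < n)%N ->
  dotn (Lzn z d f) (Lzn z d g) = dotn f g.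
Proof.
by move=> n0; elim: d => //= d <-; rewrite Existence.Lz_isometry// addn_gt0 n0 orbT.
Qed.

End Lift.

(** * Bound for an intertwining form *)

Section Estimate.
Variable R : realType.
Local Notation C := R[i].

(** The eigenvalue of the lift from level [n] to level [d + n] on vectors with
    Jucys-Murphy eigenvalues [c]. *)
Definition lift_factor (z : C) n d (c : nat -> C) : C :=
  Lz_scale z n d * \prod_(i < d) (z + c (i + n)%N).

Lemma dotn_orthonormal m N (v : 'I_N -> Hn R m) (x : 'I_N -> C) :
  (forall i j, dotn (v i) (v j) = (i == j)%:R) ->
  dotn (\sum_i x i *: v i) (\sum_i x i *: v i) = \sum_i `|x i| ^+ 2.
Proof.
move=> vv; rewrite dotn_suml; apply: eq_bigr => i _.
rewrite dotn_sumr (bigD1 i)//= big1 ?addr0 => [|j ne].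
  by rewrite dotnZ dotnZr vv eqxx mulr1 normCK.
by rewrite dotnZ dotnZr vv eq_sym (negPf ne) !mulr0.
Qed.

(** In an eigenbasis [B (v i) (v j)] vanishes unless the eigenvalues of [v i] and
    [v j] agree.  Where they agree, the coefficient [phi z1 i * (phi z2 j)^*] of
    the pair equals [u i * phi w i * (phi w j)^*], with [|u i|] bounded by the
    hypothesis; so [B] is evaluated at a damped version of the lift of [f] for [w]
    and at the lift of [h] for [w], whose norms are those of [f] and [h]. *)
Lemma intertwining_form_bound (z1 z2 w : C) n d (U : C)
    (B : Hn R (d + n) -> Hn R (d + n) -> C) (f h : Hn R n) :
  (0 < n)%N ->
  (forall a f g h, B (a *: f + g) h = a * B f h + B g h) ->
  (forall a f g h, B h (a *: f + g) = a^* * B h f + B h g) ->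
  (forall k f h, B (JM k f) h = B f (JM k h)) ->
  (forall f h, `|B f h| ^+ 2 <= dotn f f * dotn h h) ->
  (forall c, @JM_spectrum R (d + n) c -> lift_factor w n d c != 0 /\
    `|lift_factor z1 n d c| ^+ 2 * `|lift_factor z2 n d c| ^+ 2
      <= U * `|lift_factor w n d c| ^+ 4) ->
  `|B (Lzn z1 d f) (Lzn z2 d h)| ^+ 2 <= U * (dotn f f * dotn h h).
Proof.
move=> n0 Bl Br BJM Bbd key.
have [N [v [chi [vv vE vchi]]]] := JM_eigenbasis R (d + n).
have v0 i : v i != 0 by rewrite -dotn_eq0 vv eqxx oner_eq0.
have chi_spec i : @JM_spectrum R (d + n) (chi i) by exists (v i).
pose phi z i := lift_factor z n d (chi i).
have LE z g i : dotn (Lzn z d g) (v i) = phi z i * dotn (zero_extn d g) (v i).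
  exact: Lzn_dot.
have B0l g : B 0 g = 0.
  have := Bl 1 0 0 g; rewrite scaler0 addr0 mul1r => e.
  by apply: (addrI (B 0 g)); rewrite -e addr0.
have B0r g : B g 0 = 0.
  have := Br 1 0 0 g; rewrite scaler0 addr0 conjC1 mul1r => e.
  by apply: (addrI (B g 0)); rewrite -e addr0.
have Bsuml (x : 'I_N -> C) g : B (\sum_i x i *: v i) g = \sum_i x i * B (v i) g.
  by apply: (big_rec2 (fun f y => B f g = y)) => // i y ? _ <-; rewrite Bl.
have Bsumr (x : 'I_N -> C) g : B g (\sum_i x i *: v i) = \sum_i (x i)^* * B g (v i).
  by apply: (big_rec2 (fun f y => B g f = y)) => // i y ? _ <-; rewrite Br.
have Bij z i j : B (v i) (v j) != 0 -> phi z i = phi z j.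
  move=> Bn; congr (_ * _); apply: eq_bigr => k _; congr (_ + _).
  have km : (k + n < d + n)%N by rewrite ltn_add2r.
  pose k' := Ordinal km; apply: (mulIf Bn).
  have := BJM k' (v i) (v j); rewrite !vchi /=.
  have := Bl (chi i (k + n)%N) (v i) 0 (v j); rewrite addr0 B0l addr0 => ->.
  have := Br (chi j (k + n)%N) (v j) 0 (v i); rewrite addr0 B0r addr0 => ->.
  by rewrite (JM_eigen_real (v0 j) (vchi j k')).
pose u i := phi z1 i * (phi z2 i)^* / `|phi w i| ^+ 2.
pose F := \sum_i (u i * dotn (Lzn w d f) (v i)) *: v i.
have -> : B (Lzn z1 d f) (Lzn z2 d h) = B F (Lzn w d h).
  rewrite [Lzn z1 d f]vE [Lzn z2 d h]vE [Lzn w d h]vE !Bsuml; apply: eq_bigr => i _.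
  rewrite !Bsumr !mulr_sumr; apply: eq_bigr => j _; rewrite !LE.
  have [->|Bn] := eqVneq (B (v i) (v j)) 0; first by rewrite !mulr0.
  rewrite -!(Bij _ _ _ Bn) /u normCK.
  rewrite [(phi z2 i * _)^*]rmorphM [(phi w i * dotn (zero_extn d h) _)^*]rmorphM /=.
  by field; rewrite conjC_eq0 andbb (proj1 (key _ (chi_spec i))).
rewrite (le_trans (Bbd _ _))// Lzn_isometry// mulrA ler_wpM2r ?Existence.dotn_ge0//.
rewrite dotn_orthonormal// -(Lzn_isometry w d f f n0) [in leRHS](vE (Lzn w d f)).
rewrite dotn_orthonormal// mulr_sumr ler_sum// => i _.
rewrite normrM exprMn ler_wpM2r ?exprn_ge0// /u.
have [phi0 hphi] := key _ (chi_spec i); move: phi0 hphi.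
rewrite -/(phi w i) -/(phi z1 i) -/(phi z2 i).
move: (phi z1 i) (phi z2 i) (phi w i) => p1 p2 q q0 hq.
rewrite !normrM norm_conjC normfV normrX normr_id !exprMn exprVn -exprM.
by rewrite ler_pdivrMr// exprn_gt0// normr_gt0.
Qed.

End Estimate.

(** * Elementary real estimates *)

Section RealEstimates.
Variable R : realType.

Lemma weierstrass_prod (J : finType) (r : seq J) (x : J -> R) :
  (forall j, 0 <= x j <= 1) ->
  1 - \sum_(j <- r) x j <= \prod_(j <- r) (1 - x j).
Proof.
move=> x01; elim: r => [|j r IH]; first by rewrite !big_nil subr0.
rewrite !big_cons; have /andP[x0 x1] := x01 j.
have s0 : 0 <= \sum_(j <- r) x j by apply: sumr_ge0 => i _; case/andP: (x01 i).
apply: le_trans (ler_wpM2l _ IH); last by rewrite subr_ge0.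
by rewrite -subr_ge0 (_ : _ - _ = x j * \sum_(j <- r) x j); [rewrite mulr_ge0|ring].
Qed.

(** Grouping the factors by the value of [p] leaves each [1 - x j] with an exponent
    at most [M], and the product over [j] is bounded below by Weierstrass. *)
Lemma prod_by_multiplicity (I J : finType) (p : I -> J) (x : J -> R) M :
  (forall j, 0 <= x j <= 1) -> \sum_j x j <= 1 ->
  (forall j, (#|[pred i | p i == j]| <= M)%N) ->
  (1 - \sum_j x j) ^+ M <= \prod_i (1 - x (p i)).
Proof.
move=> x01 s1 pM; rewrite (partition_big p predT)//=.
have := weierstrass_prod (index_enum J) x01.
move=> /(lerXn2r M) /=; rewrite !nnegrE subr_ge0 s1 => /(_ isT).
have p0 : 0 <= \prod_(j : J) (1 - x j).
  by apply: prodr_ge0 => j _; case/andP: (x01 j); rewrite subr_ge0.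
move=> /(_ p0) /le_trans; apply; rewrite -prodrXl.
apply: ler_prod => j _; have /andP[xj0 xj1] := x01 j.
rewrite exprn_ge0 ?subr_ge0//=.
under eq_bigr => i /eqP -> do over.
rewrite prodr_const ler_wiXn2l ?subr_ge0 ?gerBl//; exact: pM.
Qed.

(** The summand is at most [4 / ((j + 1) * (j + 2))], which telescopes. *)
Lemma sum_inv_1Dsqr (m : nat) : \sum_(j < m) (1 + j%:R ^+ 2)^-1 <= 4 :> R.
Proof.
suff: \sum_(j < m) (1 + j%:R ^+ 2)^-1 <= 4 - 4 / (m%:R + 1) :> R.
  by move/le_trans; apply; rewrite gerBl divr_ge0// addr_ge0.
elim: m => [|m IH]; first by rewrite big_ord0 add0r divr1 subrr.
rewrite big_ord_recr /=; apply: le_trans (lerD IH (lexx _)) _.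
have m0 : 0 <= m%:R :> R by [].
rewrite -[m.+1%:R]natr1; move: (m%:R) m0 => y y0.
rewrite -subr_ge0 (_ : _ - _ =
   (3 * y ^+ 2 - 3 * y + 2) / ((y + 1) * (y + 1 + 1) * (1 + y ^+ 2))).
  by rewrite divr_ge0//; nra.
by field; rewrite !gt_eqF//; nra.
Qed.

(** With [q * e >= 1], Bernoulli gives
    [(1 + e / (y + i)) ^ q >= (y + i + 1) / (y + i)], and this product telescopes. *)
Lemma prod_inv_linear_unbounded (y e K : R) : 0 < y -> 0 < e ->
  exists d, K <= \prod_(i < d) (1 + e / (y + i%:R)).
Proof.
move=> y0 e0; have [q qe] : exists q : nat, 1 <= q.+1%:R * e.
  have := archi_boundP (ltW (divr_gt0 ltr01 e0)); move: (Num.bound _) => q qe.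
  exists q; rewrite -ler_pdivrMr//; apply: le_trans (ltW qe) _.
  by rewrite ler_nat.
have K0 : 0 <= `|K| by [].
have [d dK] : exists d : nat, `|K| ^+ q.+1 * y <= y + d%:R.
  have KX : 0 <= `|K| ^+ q.+1 * y by rewrite mulr_ge0 ?exprn_ge0// ltW.
  have := archi_boundP KX; move: (Num.bound _) => d hd.
  by exists d; rewrite (le_trans (ltW hd))// lerDr ltW.
exists d; apply: le_trans (ler_norm _) _.
have P0 k : 0 <= \prod_(i < k) (1 + e / (y + i%:R)).
  by apply: prodr_ge0 => i _; rewrite addr_ge0// divr_ge0// ?ltW// ltr_wpDr.
rewrite -(@ler_pXn2r _ q.+1)// ?nnegrE//.
suff h k : y + k%:R <= y * (\prod_(i < k) (1 + e / (y + i%:R))) ^+ q.+1.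
  by rewrite -(ler_pM2r y0) (le_trans dK)// mulrC h.
elim: k => [|k IH]; first by rewrite big_ord0 expr1n mulr1 addr0.
rewrite big_ord_recr /= exprMn mulrA.
have yk : 0 < y + k%:R by rewrite ltr_wpDr.
apply: (@le_trans _ _ ((y + k%:R) * (1 + e / (y + k%:R)) ^+ q.+1)); last first.
  by rewrite ler_wpM2r// exprn_ge0// addr_ge0// divr_ge0 ?ltW.
have bern (a : R) (r : nat) : 0 <= a -> 1 + r%:R * a <= (1 + a) ^+ r.
  move=> a0; elim: r => [|r IHr]; first by rewrite mul0r addr0.
  rewrite exprSr; apply: le_trans (ler_wpM2r _ IHr); last by rewrite addr_ge0.
  rewrite -natr1; have : 0 <= r%:R * a * a by rewrite !mulr_ge0.
  nra.
have a0 : 0 <= e / (y + k%:R) by rewrite divr_ge0 ?ltW.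
apply: le_trans (ler_wpM2l (ltW yk) (bern _ q.+1 a0)).
rewrite mulrDr mulr1 mulrA mulrCA mulrA mulfK ?gt_eqF//.
by rewrite -natr1 addrA lerD2l.
Qed.

End RealEstimates.

(** * A third parameter that dominates the product of two *)

Section Comparison.
Variable R : realType.

(** [|z + c| ^ 2] for a real number [c]. *)
Definition sqnorm_shift (z : R[i]) (c : R) : R :=
  (complex.Re z + c) ^+ 2 + complex.Im z ^+ 2.

Lemma sqnorm_shift_ge0 z c : 0 <= sqnorm_shift z c.
Proof. by rewrite addr_ge0 ?sqr_ge0. Qed.

(** [D < 1] is the gain in the arithmetic-geometric inequality at the content [c0].
    In [cmp_eps], the bound on [A c] by [s * (1 + c ^ 2)] makes the sum of
    [e / A c] over the integers at most [8 * e / s], hence at most [(1 - D) / 2]. *)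
Record comparison (z1 z2 w : R[i]) (c0 : bool) (D : R) : Prop := {
  cmp_D : 0 < D < 1 ;
  cmp_eps : exists e s : R, [/\ 0 < e, 16 * e <= (1 - D) * s,
    forall c, s * (1 + c ^+ 2) <= (sqnorm_shift z1 c + sqnorm_shift z2 c) / 2
    & forall c, sqnorm_shift w c = (sqnorm_shift z1 c + sqnorm_shift z2 c) / 2 - e] ;
  cmp_c0 : sqnorm_shift z1 c0%:R * sqnorm_shift z2 c0%:R
    <= D * ((sqnorm_shift z1 c0%:R + sqnorm_shift z2 c0%:R) / 2) ^+ 2 }.

(** [A c = (x + c) ^ 2 + k], where [k] is positive because [z1] and [z2] are neither
    equal nor both the same real number. *)
Lemma comparison_exists (z1 z2 : R[i]) :
  0 <= complex.Im z1 -> 0 <= complex.Im z2 -> z1 <> z2 ->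
  exists w c0 D, comparison z1 z2 w c0 D.
Proof.
case: z1 z2 => x1 y1 [x2 y2] /= y1_ge0 y2_ge0 z12.
pose Q1 c := sqnorm_shift (Complex x1 y1) c; pose Q2 c := sqnorm_shift (Complex x2 y2) c.
have [c0 Qc0] : exists c0 : bool, Q1 c0%:R != Q2 c0%:R.
  have [Q0|] := eqVneq (Q1 0) (Q2 0); last by exists false.
  exists true; apply/eqP => Qe1; apply: z12.
  have xE : x1 = x2 by move: Q0 Qe1; rewrite /Q1 /Q2 /sqnorm_shift /=; nra.
  have : y1 ^+ 2 = y2 ^+ 2 by move: Q0; rewrite /Q1 /Q2 /sqnorm_shift /= xE; lra.
  by move/eqP; rewrite eqrXn2// => /eqP ->; rewrite xE.
pose x := (x1 + x2) / 2.
pose k := (x1 - x2) ^+ 2 / 4 + (y1 ^+ 2 + y2 ^+ 2) / 2.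
have AE c : (Q1 c + Q2 c) / 2 = (x + c) ^+ 2 + k.
  by rewrite /Q1 /Q2 /sqnorm_shift /x /k /=; field.
have k0 : 0 < k.
  have k_ge0 : 0 <= k.
    by rewrite addr_ge0// divr_ge0// ?addr_ge0 ?sqr_ge0.
  rewrite lt_def k_ge0 andbT; apply: contraNneq Qc0 => k0.
  have s1 := sqr_ge0 (x1 - x2); have s2 := sqr_ge0 y1; have s3 := sqr_ge0 y2.
  have e1 : (x1 - x2) ^+ 2 = 0 by move: k0; rewrite /k; lra.
  have e2 : y1 ^+ 2 = 0 by move: k0; rewrite /k; lra.
  have e3 : y2 ^+ 2 = 0 by move: k0; rewrite /k; lra.
  move/eqP: e1; rewrite sqrf_eq0 subr_eq0 => /eqP x12.
  by rewrite /Q1 /Q2 /sqnorm_shift /= e2 e3 x12.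
pose A0 := (Q1 c0%:R + Q2 c0%:R) / 2.
have A0_gt0 : 0 < A0 by rewrite /A0 AE ltr_wpDl ?sqr_ge0.
pose r := Q1 c0%:R * Q2 c0%:R / A0 ^+ 2.
have r0 : 0 <= r by apply: divr_ge0; [apply: mulr_ge0; exact: sqnorm_shift_ge0|exact: sqr_ge0].
have r1 : r < 1.
  rewrite ltr_pdivrMr ?exprn_gt0// mul1r -subr_gt0.
  rewrite (_ : _ - _ = ((Q1 c0%:R - Q2 c0%:R) / 2) ^+ 2); last by rewrite /A0; field.
  by rewrite exprn_even_gt0//= mulf_neq0 ?subr_eq0 ?invr_eq0 ?pnatr_eq0.
pose D := (1 + r) / 2.
pose s := k / (1 + x ^+ 2 + k).
have den0 : 0 < 1 + x ^+ 2 + k by rewrite addr_gt0// ltr_pwDl// sqr_ge0.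
have s0 : 0 < s by rewrite divr_gt0.
have s1 : s < 1.
  by rewrite ltr_pdivrMr// mul1r ltrDr ltr_pwDl// sqr_ge0.
have sk : s * (1 + x ^+ 2 + k) = k by rewrite divfK// gt_eqF.
pose e := (1 - D) * s / 16.
have D1 : D < 1 by rewrite /D; lra.
have D0 : 0 < D by rewrite /D; lra.
have e0 : 0 < e by rewrite /e divr_gt0// mulr_gt0// subr_gt0.
have ek : e < k.
  have sx : 0 <= s * x ^+ 2 by rewrite mulr_ge0 ?sqr_ge0// ltW.
  have skk : 0 < s * k by rewrite mulr_gt0.
  have s_le_k : s < k.
    move: sk sx skk; rewrite !mulrDr mulr1; move: (s * _) (s * k) => a b.
    by clearbody s k; lra.
  have : (1 - D) * s <= s by rewrite ler_piMl ?(ltW s0)// gerBl ltW.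
  rewrite /e; lra.
exists (Complex x (Num.sqrt (k - e))), c0, D; split.
- by rewrite D0.
- exists e, s; split=> // [|c|c].
  + by rewrite /e; lra.
  + rewrite AE -(ler_pM2l (_ : 0 < 1 - s)) ?subr_gt0// -subr_ge0.
    have -> : (1 - s) * ((x + c) ^+ 2 + k) - (1 - s) * (s * (1 + c ^+ 2))
        = ((1 - s) * c + x) ^+ 2 + s ^+ 2.
      have -> : k = s * (1 + x ^+ 2 + k) by rewrite sk.
      by move: sk; move: (s) => s' sk'; nra.
    by rewrite addr_ge0 ?sqr_ge0.
  + by rewrite AE /sqnorm_shift /= sqr_sqrtr ?subr_ge0 ?ltW//; ring.
- rewrite -/(Q1 _) -/(Q2 _) -/A0 -ler_pdivrMr ?exprn_gt0// -/r /D; lra.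
Qed.

(** Integers of absolute value less than [m], as a finite type; [0] occurs twice,
    which only weakens the estimates below. *)
Definition sgn_nat m (q : bool * 'I_m) : R := (-1) ^+ q.1 * q.2%:R.

(** Every occurrence of [c0] gains a factor [D] over the product of the [A c] squared,
    while passing from [A] to [A - e] costs at most [1 - \sum_q x q] for each
    repetition of the whole range of contents, and that number squared is at least
    [D]. *)
Lemma content_comparison z1 z2 w c0 D d m M (p : 'I_d -> bool * 'I_m) :
  comparison z1 z2 w c0 D ->
  (forall q, (#|[pred i | p i == q]|
     <= #|[pred i | sgn_nat (p i) == c0%:R]| + M)%N) ->
  D ^+ M * \prod_i (sqnorm_shift z1 (sgn_nat (p i)) * sqnorm_shift z2 (sgn_nat (p i)))
    <= \prod_i sqnorm_shift w (sgn_nat (p i)) ^+ 2.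
Proof.
move=> [/andP[D0 D1] [e [s [e0 es As wE]]] Dc0] pM.
pose A c := (sqnorm_shift z1 c + sqnorm_shift z2 c) / 2.
set N0 := #|[pred i | sgn_nat (p i) == c0%:R]| in pM.
have s0 : 0 < s.
  by rewrite -(pmulr_rgt0 _ (_ : 0 < 1 - D)) ?subr_gt0// (lt_le_trans _ es)// mulr_gt0.
have As' c : s <= A c.
  by apply: le_trans (As c); rewrite ler_peMr ?(ltW s0)// lerDl sqr_ge0.
have A0 c : 0 < A c by exact: lt_le_trans (As' c).
have De : (1 - D) * s <= s by rewrite ler_piMl ?(ltW s0)// gerBl ltW.
pose x (q : bool * 'I_m) := e / A (sgn_nat q).
have x01 q : 0 <= x q <= 1.
  rewrite divr_ge0 ?(ltW e0) ?(ltW (A0 _))//= ler_pdivrMr// mul1r.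
  by apply: le_trans (As' _); lra.
have xs : \sum_q x q <= (1 - D) / 2.
  rewrite -(pair_bigA _ (fun b j => x (b, j))) /=.
  have hb b : \sum_(j < m) x (b, j) <= (1 - D) / 4.
    apply: (@le_trans _ _ (\sum_(j < m) e / s * (1 + j%:R ^+ 2)^-1)).
      apply: ler_sum => j _; rewrite /x -mulrA ler_wpM2l ?(ltW e0)// -invfM.
      have s1 : 0 < s * (1 + j%:R ^+ 2).
        by rewrite mulr_gt0// ltr_wpDr ?sqr_ge0.
      rewrite lef_pV2 ?posrE//; have := As (sgn_nat (b, j)).
      by rewrite /sgn_nat exprMn sqrr_sign mul1r.
    rewrite -mulr_sumr.
    apply: le_trans (ler_wpM2l _ (sum_inv_1Dsqr _ m)) _; first by rewrite divr_ge0 ?ltW.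
    by rewrite mulrAC ler_pdivrMr//; lra.
  by rewrite big_bool /=; have := hb true; have := hb false; lra.
have DS : D <= (1 - \sum_q x q) ^+ 2 by nra.
have S1 : \sum_q x q <= 1 by lra.
have wA c : sqnorm_shift w c = A c * (1 - e / A c).
  by rewrite wE mulrBr mulr1 mulrCA divff ?mulr1// gt_eqF.
under [leRHS]eq_bigr => i _ do rewrite wA exprMn.
rewrite [leRHS]big_split /= [X in _ <= _ * X]prodrXl.
have P0 : 0 <= \prod_i A (sgn_nat (p i)) ^+ 2.
  by apply: prodr_ge0 => i _; rewrite sqr_ge0.
have le1 : \prod_i (sqnorm_shift z1 (sgn_nat (p i)) * sqnorm_shift z2 (sgn_nat (p i)))
    <= D ^+ N0 * \prod_i A (sgn_nat (p i)) ^+ 2.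
  have -> : D ^+ N0 = \prod_i (if sgn_nat (p i) == c0%:R then D else 1).
    by rewrite -big_mkcond prodr_const.
  rewrite -big_split; apply: ler_prod => i _.
  rewrite mulr_ge0 ?sqnorm_shift_ge0//=; case: eqP => [->//|_].
  rewrite mul1r /A -subr_ge0.
  rewrite (_ : _ - _ = ((sqnorm_shift z1 (sgn_nat (p i))
    - sqnorm_shift z2 (sgn_nat (p i))) / 2) ^+ 2).
    by rewrite sqr_ge0.
  by field.
apply: le_trans (ler_wpM2l (exprn_ge0 _ (ltW D0)) le1) _.
rewrite mulrA mulrC ler_wpM2l// -exprD addnC.
have := prod_by_multiplicity x01 S1 pM; set P := \prod_i _ => hP.
have S0 : 0 <= 1 - \sum_q x q by lra.
apply: le_trans (_ : ((1 - \sum_q x q) ^+ (N0 + M)) ^+ 2 <= _); last first.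
  by rewrite lerXn2r ?nnegrE ?exprn_ge0// (le_trans _ hP)// exprn_ge0.
by rewrite -exprM mulnC exprM lerXn2r ?nnegrE ?sqr_ge0// ltW.
Qed.

End Comparison.

(** * Decay of the intertwining bound *)

Section LiftFactor.
Variable R : realType.
Local Notation C := R[i].
Local Open Scope complex_scope.

Lemma sqr_norm_addC (z : C) (c : R) : `|z + c%:C| ^+ 2 = (sqnorm_shift z c)%:C.
Proof.
case: z => x y; rewrite normc_def /= -rmorphXn /= sqr_sqrtr ?addr0//.
by rewrite addr_ge0 ?sqr_ge0.
Qed.

(** The square of the scalar factor of [Lz z] at level [k]. *)
Definition level_weight (z : C) (k : nat) : R := k.+1%:R / (sqnorm_shift z 0 + k%:R).

Lemma sqr_norm_lift_factor z n d c (x : 'I_d -> R) :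
  (forall i : 'I_d, c (i + n)%N = (x i)%:C) ->
  `|lift_factor z n d c| ^+ 2 =
  (\prod_(i < d) (level_weight z (i + n) * sqnorm_shift z (x i)))%:C.
Proof.
move=> cx; have zE : `|z| ^+ 2 = (sqnorm_shift z 0)%:C.
  by rewrite -sqr_norm_addC rmorph0 addr0.
rewrite normrM exprMn /Lz_scale !normr_prod -!prodrXl.
rewrite [in RHS]big_split /= rmorphM /= !rmorph_prod; congr (_ * _).
  apply: eq_bigr => i _; rewrite zE -!(rmorph_nat (real_complex R)) -rmorphD -fmorph_div /=.
  rewrite -/(level_weight z (i + n)) ger0_norm ?sqrtCK// sqrtC_ge0 ler0c.
  by rewrite divr_ge0// addr_ge0// sqnorm_shift_ge0.
by apply: eq_bigr => i _; rewrite cx sqr_norm_addC.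
Qed.

Lemma cnt_add (c : nat -> C) x d n :
  cnt c x (d + n) = (cnt c x n + #|[pred i : 'I_d | c (i + n)%N == x]|)%N.
Proof.
rewrite -sum1_card big_mkcond /=.
elim: d => [|d IH]; first by rewrite big_ord0 addn0.
by rewrite addSn cntS IH big_ord_recr /= !inE addnA; case: eqP.
Qed.

Lemma cnt_le (c : nat -> C) x n : (cnt c x n <= n)%N.
Proof.
elim: n => [|n IH]; first by rewrite /cnt big_ord0.
by rewrite cntS -addn1 leq_add// leq_b1.
Qed.

(** Contents are integers, none is more frequent than [0], and [0] occurs at most
    once more than [1]; the [n] entries below level [n] account for the rest. *)
Lemma spectrum_values n d c (c0 : bool) : @JM_spectrum R (d + n) c ->
  exists p : 'I_d -> bool * 'I_(d + n),
    (forall i : 'I_d, c (i + n)%N = (sgn_nat R (p i))%:C) /\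
    forall q, (#|[pred i | p i == q]|
      <= #|[pred i | sgn_nat R (p i) == c0%:R]| + n.+1)%N.
Proof.
move=> Sc; have fam := JM_content_family R (d + n).
have [p pE] : exists p : 'I_d -> bool * 'I_(d + n),
    forall i : 'I_d, c (i + n)%N = (sgn_nat R (p i))%:C.
  suff : forall i : 'I_d, exists q : bool * 'I_(d + n),
    c (i + n)%N = (sgn_nat R q)%:C by move=> /boolp.choice[p pE]; exists p.
  move=> i.
  have im : (i + n < d + n)%N by rewrite ltn_add2r.
  have [z -> zi] := content_integer fam Sc im.
  exists ((z < 0)%R, Ordinal (leq_ltn_trans zi im)); rewrite /sgn_nat /=.
  by rewrite {1}(intEsign z) !rmorphM /= !rmorph_sign rmorph_nat.
exists p; split=> // q; pose a : C := (sgn_nat R q)%:C.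
have le1 : (#|[pred i | p i == q]| <= cnt c a (d + n))%N.
  rewrite cnt_add (leq_trans _ (leq_addl _ _))//; apply: subset_leq_card.
  by apply/fintype.subsetP => i; rewrite !inE => /eqP pi; rewrite pE pi.
have le2 : (cnt c a (d + n) <= (cnt c (c0%:R : C) (d + n)).+1)%N.
  have := cnt_le_cnt0 fam ((-1) ^+ q.1 * q.2%:Z) Sc.
  have -> : ((-1) ^+ q.1 * q.2%:Z)%:~R = a.
    by rewrite /a /sgn_nat !rmorphM /= !rmorph_sign rmorph_nat.
  move=> h; apply: leq_trans h _; case: c0; last exact: leqnSn.
  by have := cnt_0_1 fam Sc.
apply: leq_trans le1 (leq_trans le2 _); rewrite cnt_add addnS ltnS addnC.
rewrite leq_add ?cnt_le//; apply: subset_leq_card; apply/fintype.subsetP => i.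
rewrite !inE pE => /eqP h; apply/eqP/complexI; rewrite h.
by rewrite rmorph_nat.
Qed.

(** The scalar weights have ratio [(T + k - e) ^ 2 / ((T + k) ^ 2 - del ^ 2)], which
    is at most [(1 + e / (T + k))^-1] as soon as [del ^ 2 <= e * (T + k)]; this is
    where [n] has to be large. *)
Lemma lift_factor_small (z1 z2 : C) :
  0 <= complex.Im z1 -> 0 <= complex.Im z2 -> z1 <> z2 ->
  exists w n0, forall n, (n0 <= n)%N -> forall eta : R, 0 < eta ->
  exists d, forall c, @JM_spectrum R (d + n) c ->
    lift_factor w n d c != 0 /\
    `|lift_factor z1 n d c| ^+ 2 * `|lift_factor z2 n d c| ^+ 2
      <= eta%:C * `|lift_factor w n d c| ^+ 4.
Proof.
move=> Im1 Im2 z12; have [w [c0 [D cmp]]] := comparison_exists Im1 Im2 z12.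
have [/andP[D0 D1] [e [s [e0 es As wE]]] _] := cmp.
pose T := (sqnorm_shift z1 0 + sqnorm_shift z2 0) / 2.
pose del := (sqnorm_shift z1 0 - sqnorm_shift z2 0) / 2.
have T0 : 0 <= T by rewrite divr_ge0// addr_ge0// sqnorm_shift_ge0.
have eT : e <= T by have := sqnorm_shift_ge0 w 0; rewrite wE -/T; lra.
have [n0 n0E] : exists n0 : nat, del ^+ 2 <= e * n0.+1%:R.
  have := archi_boundP (divr_ge0 (sqr_ge0 del) (ltW e0)).
  move: (Num.bound _) => n0 h; exists n0; rewrite mulrC -ler_pdivrMr//.
  by apply: le_trans (ltW h) _; rewrite ler_nat.
have s0 : 0 < s.
  by rewrite -(pmulr_rgt0 _ (_ : 0 < 1 - D)) ?subr_gt0// (lt_le_trans _ es)// mulr_gt0.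
have w_gt0 x : 0 < sqnorm_shift w x.
  rewrite wE subr_gt0; apply: lt_le_trans (As x).
  apply: (@lt_le_trans _ _ s); last by rewrite ler_peMr ?(ltW s0)// lerDl sqr_ge0.
  have : (1 - D) * s <= s by rewrite ler_piMl ?(ltW s0)// gerBl ltW.
  lra.
have lw_gt0 z k : (0 < k)%N -> 0 < level_weight z k.
  by move=> k0; rewrite divr_gt0// ltr_wpDl ?sqnorm_shift_ge0 ?ltr0n.
exists w, n0.+1 => n n0n eta eta0.
have n_gt0 : (0 < n)%N by exact: leq_trans n0n.
have [|d dE] := @prod_inv_linear_unbounded R (T + n%:R) e ((eta * D ^+ n.+1)^-1) _ e0.
  by rewrite ltr_wpDl// ltr0n.
exists d => c /spectrum_values-/(_ c0)[p [pE pM]].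
have cmpP := content_comparison cmp pM.
have normE z := sqr_norm_lift_factor z pE.
set x := fun i => sgn_nat R (p i).
have kn0 (i : 'I_d) : (0 < i + n)%N by rewrite addn_gt0 n_gt0 orbT.
split.
  rewrite -normr_eq0 -sqrf_eq0 normE -(rmorph0 (real_complex R)).
  rewrite (inj_eq (@complexI _)) gt_eqF//; apply: prodr_gt0 => i _.
  by rewrite mulr_gt0 ?lw_gt0.
rewrite (exprM _ 2 2) !normE -rmorphM -rmorphXn -rmorphM /= lecR.
pose Q := \prod_i (sqnorm_shift z1 (x i) * sqnorm_shift z2 (x i)).
pose a := \prod_(i < d) (level_weight z1 (i + n) * level_weight z2 (i + n)).
pose lw := \prod_(i < d) level_weight w (i + n) ^+ 2.
pose Qw := \prod_i sqnorm_shift w (x i) ^+ 2.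
have -> : \prod_(i < d) (level_weight z1 (i + n) * sqnorm_shift z1 (x i))
    * \prod_(i < d) (level_weight z2 (i + n) * sqnorm_shift z2 (x i)) = a * Q.
  by rewrite -!big_split; apply: eq_bigr => i _ /=; rewrite mulrACA.
have -> : (\prod_(i < d) (level_weight w (i + n) * sqnorm_shift w (x i))) ^+ 2 = lw * Qw.
  by rewrite -prodrXl -big_split; apply: eq_bigr => i _ /=; rewrite exprMn.
rewrite mulrA.
have a_gt0 : 0 < a.
  by apply: prodr_gt0 => i _; rewrite mulr_gt0// lw_gt0.
have DM : 0 < D ^+ n.+1 by rewrite exprn_gt0.
have Qw0 : 0 <= Qw by apply: prodr_ge0 => i _; rewrite sqr_ge0.
suff h : a <= eta * D ^+ n.+1 * lw.
  rewrite -(ler_pM2l DM) mulrCA.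
  apply: (@le_trans _ _ (a * Qw)); first by rewrite ler_wpM2l// ltW.
  apply: le_trans (ler_wpM2r Qw0 h) _.
  by rewrite le_eqVlt; apply/orP; left; apply/eqP; ring.
have key : a * \prod_(i < d) (1 + e / (T + n%:R + i%:R)) <= lw.
  rewrite /a /lw -big_split; apply: ler_prod => i _ /=.
  have u_ge : n0.+1%:R <= (i + n)%:R :> R by rewrite ler_nat (leq_trans n0n)// leq_addl.
  have -> : T + n%:R + i%:R = T + (i + n)%:R by rewrite natrD addrA addrAC.
  rewrite /level_weight wE -/T.
  set k := (i + n)%N in u_ge *; set K := (_.+1)%:R.
  have k0 : 0 < k%:R :> R by apply: lt_le_trans u_ge.
  have q1 := sqnorm_shift_ge0 z1 0; have q2 := sqnorm_shift_ge0 z2 0.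
  have tw : 0 < T - e + k%:R by lra.
  have u0 : 0 < T + k%:R by lra.
  have t1 : 0 < sqnorm_shift z1 0 + k%:R by lra.
  have t2 : 0 < sqnorm_shift z2 0 + k%:R by lra.
  have p1 : 0 <= 1 + e / (T + k%:R) by rewrite addr_ge0// divr_ge0// ltW.
  have K0 : 0 <= K by [].
  apply/andP; split; first by rewrite !mulr_ge0// invr_ge0 ltW.
  have split_factor (a1 a2 u : R) : 0 < a1 -> 0 < a2 -> 0 < u ->
      K / a1 * (K / a2) * (1 + e / u) = K ^+ 2 * ((u + e) / (a1 * a2 * u)).
    by move=> a1_gt0 a2_gt0 u_gt0; field; rewrite !gt_eqF.
  rewrite split_factor//.
  rewrite expr_div_n ler_wpM2l ?sqr_ge0//.
  rewrite ler_pdivrMr ?mulr_gt0// mulrC ler_pdivlMr ?exprn_gt0//.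
  have -> : (sqnorm_shift z1 0 + k%:R) * (sqnorm_shift z2 0 + k%:R) = (T + k%:R) ^+ 2 - del ^+ 2.
    by rewrite /T /del; field.
  have du : del ^+ 2 <= e * (T + k%:R).
    by apply: le_trans n0E _; rewrite ler_pM2l//; lra.
  move: du u0 tw; rewrite addrAC; move: (T + k%:R) => u du u0 tw.
  have : 0 <= u * (e * u - del ^+ 2) by rewrite mulr_ge0 ?subr_ge0// ltW.
  have : 0 <= e ^+ 2 * (u - e) by rewrite mulr_ge0 ?sqr_ge0// ltW.
  nra.
have eD : 0 < eta * D ^+ n.+1 by rewrite mulr_gt0.
rewrite -ler_pdivrMl//; apply: le_trans key; rewrite mulrC ler_wpM2l//.
exact: ltW.
Qed.

End LiftFactor.

(** * Orthogonal projections in Hilbert spaces *)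

Local Open Scope classical_set_scope.

Section Projection.
Variable R : realType.
Local Notation C := R[i].
Variable T : hilbertType C.
Implicit Types x y u v w : T.
Local Open Scope complex_scope.

Lemma hdotP a x y z : hdot (a *: x + y) z = a * hdot x z + hdot y z.
Proof. by rewrite linearPl. Qed.

Lemma hdotC x y : hdot x y = (hdot y x)^*%R.
Proof. by rewrite hermC expr0 mul1r. Qed.

Lemma hdot_ge0 x : 0 <= hdot x x.
Proof. by rewrite -hdot_norm exprn_ge0. Qed.

Lemma hdotB x y z : hdot (x - y) z = hdot x z - hdot y z.
Proof. exact: (Existence.sB hdotP). Qed.
Lemma hdotBr x y z : hdot z (x - y) = hdot z x - hdot z y.
Proof. exact: (Existence.sBr hdotP hdotC). Qed.
Lemma hdotZ a x y : hdot (a *: x) y = a * hdot x y.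
Proof. exact: (Existence.sZ hdotP). Qed.
Lemma hdotZr a x y : hdot x (a *: y) = a^*%R * hdot x y.
Proof. exact: (Existence.sZr hdotP hdotC). Qed.
Lemma hdotD x y z : hdot (x + y) z = hdot x z + hdot y z.
Proof. exact: (Existence.sD hdotP). Qed.
Lemma hdotDr x y z : hdot z (x + y) = hdot z x + hdot z y.
Proof. exact: (Existence.sDr hdotP hdotC). Qed.
Lemma hdot0 y : hdot 0 y = 0.
Proof. exact: (Existence.s0 hdotP). Qed.

Lemma hdot_eq0 x : hdot x x = 0 -> x = 0.
Proof. by move/eqP; rewrite -hdot_norm sqrf_eq0 normr_eq0 => /eqP. Qed.

Lemma hdot_CS x y : `|hdot x y| ^+ 2 <= hdot x x * hdot y y.
Proof. exact: (Existence.s_CS hdotP hdotC hdot_ge0). Qed.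

(** Subtracting the projection of [x] to the line of [w] lowers the square of its
    norm by [|hdot x w| ^ 2 / hdot w w]. *)
Lemma hdot_almost_min x w (eta : C) :
  (forall a : C, hdot x x <= hdot (x - a *: w) (x - a *: w) + eta) ->
  `|hdot x w| ^+ 2 <= eta * hdot w w.
Proof.
move=> xmin; have [w0|w0] := eqVneq (hdot w w) 0.
  by have := hdot_CS x w; rewrite w0 !mulr0.
have wJ : (hdot w w)^*%R = hdot w w by rewrite -hdotC.
have wp : 0 < hdot w w by rewrite lt_def w0 hdot_ge0.
have := xmin (hdot x w / hdot w w); rewrite -scaleNr.
rewrite (Existence.s_expand hdotP hdotC) rmorphN fmorph_div /= wJ.
rewrite (_ : _ + _ + eta = hdot x x + (eta - hdot x w * (hdot x w)^*%R / hdot w w)).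
  by rewrite lerDl subr_ge0 ler_pdivrMr// -normCK.
by field.
Qed.

Let N x : R := complex.Re (hdot x x).

Let NE x : hdot x x = (N x)%:C.
Proof. by rewrite /N RRe_real// ger0_real// hdot_ge0. Qed.

Let N_ge0 x : 0 <= N x.
Proof. by rewrite -ler0c -NE hdot_ge0. Qed.

(** A minimizing sequence for the distance from [v] to [W] is Cauchy by the
    parallelogram identity, and its differences with [v] are almost orthogonal to
    [W] by [hdot_almost_min]. *)
Lemma orthogonal_projection (W : set T) v : W 0 ->
  (forall a x y, W x -> W y -> W (a *: x + y)) -> closed W ->
  exists2 p, W p & forall u, W u -> hdot (v - p) u = 0.
Proof.
move=> W0 Wlin Wcl.
pose E := [set N (v - u) | u in W].
have Einf : has_inf E.
  split; first by exists (N (v - 0)), 0.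
  by exists 0 => _ [u _ <-].
have Elb u : W u -> inf E <= N (v - u).
  by move=> Wu; apply: ge_inf; [case: Einf|exists u].
have /choice[u uP] : forall k : nat, exists u, W u /\ N (v - u) < inf E + k.+1%:R^-1.
  move=> k; have [|_ [u Wu <-] h] := inf_adherent (_ : 0 < k.+1%:R^-1) Einf.
    by rewrite invr_gt0.
  by exists u.
have uu k l : N (u k - u l) <= 2 * (k.+1%:R^-1 + l.+1%:R^-1).
  have [Wk hk] := uP k; have [Wl hl] := uP l.
  pose mid := 2^-1 *: u k + 2^-1 *: u l.
  have Wmid : W mid.
    apply: (Wlin) => //; rewrite -[_ *: u l]addr0; exact: Wlin.
  have hm := Elb _ Wmid.
  have par : N (u k - u l) + 4 * N (v - mid) = 2 * N (v - u k) + 2 * N (v - u l).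
    apply: (@complexI R); rewrite !(rmorph_nat, rmorphD, rmorphM) /= -!NE.
    rewrite /mid !(hdotB, hdotBr, hdotD, hdotDr, hdotZ, hdotZr).
    rewrite fmorphV /= conjC_nat ?rmorph_nat.
    by field.
  move: hm hk hl par; move: (inf E) (N (v - mid)) (N (v - u k)) (N (v - u l)).
  by move: (N (u k - u l)) (k.+1%:R^-1) (l.+1%:R^-1) => *; lra.
have ucauchy : cvg (u @ \oo).
  apply/cauchy_cvgP/cauchyP => e e0.
  have e20 : 0 < e ^+ 2 / 4 by rewrite divr_gt0// exprn_gt0.
  have [k hk] := Existence.complex_seq_arch e20.
  exists (u k); exists k => // l /= kl; rewrite -ball_normE /=.
  rewrite -(@ltr_pXn2r _ 2) ?nnegrE ?(ltW e0)// hdot_norm NE.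
  apply: le_lt_trans (_ : ((2 * (k.+1%:R^-1 + k.+1%:R^-1))%:C : C) < _).
    rewrite lecR; apply: le_trans (uu k l) _; rewrite ler_pM2l// lerD2l.
    by rewrite lef_pV2 ?posrE// ler_nat.
  have := hk k (leqnn k); rewrite ltr_pdivlMr// => /(le_lt_trans _); apply.
  rewrite le_eqVlt; apply/orP; left; apply/eqP.
  rewrite !(rmorphD, rmorphM) fmorphV /= !rmorph_nat.
  by ring.
pose p := lim (u @ \oo).
have Wp : W p.
  apply: (closed_cvg _ Wcl _ _ ucauchy).
  by apply: nearW => k; have [] := uP k.
exists p => // w Ww.
apply: (@Existence.clim_uniq C (fun k => hdot (v - u k) w)) => e e0.
  have w1 : 0 < `|w| + 1 by rewrite ltr_wpDl.
  have /cvgrPdist_lt/(_ _ (divr_gt0 e0 w1)) [k _ hk] := ucauchy.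
  exists k => l kl; rewrite -hdotB opprB addrC addrA subrK.
  apply: (@le_lt_trans _ _ (`|p - u l| * (`|w| + 1))).
    apply: (@le_trans _ _ (`|p - u l| * `|w|)); last by rewrite ler_wpM2l// lerDl.
    rewrite -(@ler_pXn2r _ 2) ?nnegrE ?mulr_ge0//.
    by rewrite exprMn !hdot_norm hdot_CS.
  by rewrite -ltr_pdivlMr// hk.
have w1 : 0 < hdot w w + 1 by rewrite ltr_wpDl ?hdot_ge0.
have [k hk] := Existence.complex_seq_arch (divr_gt0 (exprn_gt0 2 e0) w1).
exists k => l kl; have [Wl hl] := uP l.
rewrite subr0 -(@ltr_pXn2r _ 2) ?nnegrE ?(ltW e0)//.
apply: (@le_lt_trans _ _ ((l.+1%:R^-1 : R)%:C * hdot w w)).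
  apply: hdot_almost_min => a; rewrite !NE -rmorphD lecR.
  apply: le_trans (ltW hl) _; rewrite lerD2r -addrA -opprD; apply: Elb.
  by rewrite addrC; apply: Wlin.
rewrite fmorphV rmorph_nat.
apply: (@le_lt_trans _ _ (l.+1%:R^-1 * (hdot w w + 1))).
  by rewrite ler_wpM2l ?invr_ge0// lerDl.
by rewrite -ltr_pdivlMr// hk.
Qed.

End Projection.

(** * Disjointness *)

Section Density.
Variable R : realType.
Local Notation C := R[i].

(** By Pythagoras no element of [S] is closer to [y] than [|y|]. *)
Lemma orthogonal_dense (T : hilbertType C) (S : set T) y :
  closure S = setT -> (forall v, S v -> hdot y v = 0) -> y = 0.
Proof.
move=> Sdense yS; apply/eqP; rewrite -normr_eq0.
case: eqVneq => // y0; have yp : 0 < `|y| by rewrite lt_def y0 normr_ge0.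
have : closure S y by rewrite Sdense.
move=> /(_ _ (nbhsx_ballx y `|y| yp))[v [Sv]]; rewrite -ball_normE /=.
rewrite -(@ltr_pXn2r _ 2) ?nnegrE// !hdot_norm hdotB !hdotBr (yS v Sv).
rewrite (hdotC v y) (yS v Sv) conjC0 sub0r opprK subr0 gtrDl.
by rewrite le_gtF// hdot_ge0.
Qed.

(** Linearity and equivariance follow from the uniqueness of the projection. *)
Lemma orthogonal_projection_rep (G : groupType) (T : unitary_rep C G) (W : set T) :
  subrepresentation W ->
  exists p : T -> T,
    [/\ forall v, W (p v),
        forall v u, W u -> hdot (v - p v) u = 0,
        forall a x y, p (a *: x + y) = a *: p x + p y,
        forall g x, p (rep_act T g x) = rep_act T g (p x)
      & forall v, hdot (p v) (p v) <= hdot v v].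
Proof.
move=> [W0 Wlin Wcl Wact].
have /choice[p pP] : forall v, exists p, W p /\ forall u, W u -> hdot (v - p) u = 0.
  by move=> v; have [p Wp pO] := orthogonal_projection v W0 Wlin Wcl; exists p.
have Wp v : W (p v) by case: (pP v).
have pO v u : W u -> hdot (v - p v) u = 0 by case: (pP v) => _; apply.
have uniq v q : W q -> (forall u, W u -> hdot (v - q) u = 0) -> p v = q.
  move=> Wq qO; apply/eqP; rewrite -subr_eq0; apply/eqP/hdot_eq0.
  have Wd : W (p v - q) by rewrite addrC -scaleN1r; apply: Wlin.
  rewrite {1}(_ : p v - q = (v - q) - (v - p v)); last first.
    by rewrite opprB [RHS]addrC addrA subrK.
  by rewrite hdotB qO// pO// subrr.
exists p; split=> // [a x y|g x|v].
- apply: uniq => [|u Wu]; first exact: Wlin.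
  rewrite (_ : _ - _ = a *: (x - p x) + (y - p y)); last first.
    by rewrite scalerBr opprD addrACA.
  by rewrite hdotP !pO// mulr0 addr0.
- apply: uniq => [|u Wu]; first exact: Wact.
  rewrite -linearB -[u]rep_act1 -(mulgV g) rep_actM rep_act_dot pO//.
  exact: Wact.
- have vE : v = (v - p v) + p v by rewrite subrK.
  rewrite [in leRHS]vE; move: (v - p v) (pO v _ (Wp v)) => q qp.
  rewrite hdotD !hdotDr qp [hdot (p v) q]hdotC qp conjC0 addr0 add0r lerDr.
  exact: hdot_ge0.
Qed.

Lemma small_multiples_eq0 (x y : C) : 0 <= x -> 0 <= y ->
  (forall eta : R, 0 < eta -> x <= (eta%:C)%C * y) -> x = 0.
Proof.
move=> x0 y0 h; have xE : x = ((complex.Re x)%:C)%C by rewrite RRe_real// ger0_real.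
have yE : y = ((complex.Re y)%:C)%C by rewrite RRe_real// ger0_real.
move: x0 y0 h; rewrite {}xE {}yE; move: (complex.Re x) (complex.Re y) => a b.
rewrite !ler0c => a0 b0 h; congr (_%:C)%C.
have [//|ap] := eqVneq a 0; have {ap}a_gt0 : 0 < a by rewrite lt_def ap.
have b1 : 0 < b + 1 by rewrite ltr_wpDl.
have := h (a / (b + 1)) (divr_gt0 a_gt0 b1); rewrite -rmorphM lecR.
by rewrite mulrAC ler_pdivlMr// ler_pM2l// gerDl ler10.
Qed.

End Density.

Theorem theorem8p1p1 (R : realType) (z1 z2 : R[i])
    (T1 T2 : unitary_rep R[i] Sinf2) :
  is_generalized_regular z1 T1 -> is_generalized_regular z2 T2 ->
  0 <= complex.Im z1 -> 0 <= complex.Im z2 -> z1 <> z2 ->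
  disjoint_rep T1 T2.
Proof.
move=> [j1 [j1P j1dense j1act]] [j2 [j2P j2dense j2act]] Im1 Im2 z12.
move=> W1 W2 sW1 sW2 W1n _ [U [Ulin Udot UW Uact]].
have [p [Wp pO plin pact pnorm]] := orthogonal_projection_rep sW1.
pose B n f h := hdot (U (p (j1 n f))) (j2 n h).
have j1lin n a f g : (0 < n)%N -> j1 n (a *: f + g) = a *: j1 n f + j1 n g.
  by move=> n0; have [-> _ _] := j1P n n0.
have j2lin n a f g : (0 < n)%N -> j2 n (a *: f + g) = a *: j2 n f + j2 n g.
  by move=> n0; have [-> _ _] := j2P n n0.
have Bl n a f g h : (0 < n)%N -> B n (a *: f + g) h = a * B n f h + B n g h.
  by move=> n0; rewrite /B j1lin// plin Ulin// hdotP.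
have Br n a f g h : (0 < n)%N -> B n h (a *: f + g) = a^* * B n h f + B n h g.
  by move=> n0; rewrite /B j2lin// hdotDr hdotZr.
have Btranslate n s f h : (0 < n)%N -> B n (translate s f) h = B n f (translate s^-1%g h).
  move=> n0; rewrite /B -[h in LHS](_ : translate s (translate s^-1%g h) = h); last first.
    by rewrite translateM mulgV; apply/ffunP => x; rewrite translateE mulg1.
  rewrite /translate -(j1act n (s, 1%g))// -(j2act n (s, 1%g))// pact Uact//.
  exact: rep_act_dot.
have BJM n (k : 'I_n) f h : (0 < n)%N -> B n (JM k f) h = B n f (JM k h).
  move=> n0; have Bl' := Bl n _ _ _ _ n0; have Br' := Br n _ _ _ _ n0.
  rewrite /JM.
  apply: (big_rec2 (fun f' h' => B n f' h = B n f h')) => [|j f' h' _ IH].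
    have e1 := Bl' 1 0 0 h; rewrite scaler0 addr0 mul1r in e1.
    have e2 := Br' 1 0 0 f; rewrite scaler0 addr0 conjC1 mul1r in e2.
    rewrite (_ : B n 0 h = 0); last by apply: (addrI (B n 0 h)); rewrite -e1 addr0.
    by apply: (addrI (B n f 0)); rewrite -e2 addr0.
  have := Bl' 1 (translate (tperm j k) f) f' h; rewrite scale1r mul1r => ->.
  have := Br' 1 (translate (tperm j k) h) h' f; rewrite scale1r conjC1 mul1r => ->.
  by rewrite IH Btranslate// tpermV.
have Bbd n f h : (0 < n)%N -> `|B n f h| ^+ 2 <= dotn f f * dotn h h.
  move=> n0; apply: le_trans (hdot_CS _ _) _.
  have [_ -> _] := j2P n n0; rewrite ler_wpM2r ?Existence.dotn_ge0//.
  rewrite Udot//; apply: le_trans (pnorm _) _.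
  by have [_ -> _] := j1P n n0.
have j1L n d f : (0 < n)%N -> j1 (d + n)%N (Lzn z1 d f) = j1 n f.
  move=> n0; elim: d => //= d <-.
  by have [_ _ ->] := j1P (d + n)%N (leq_trans n0 (leq_addl _ _)).
have j2L n d f : (0 < n)%N -> j2 (d + n)%N (Lzn z2 d f) = j2 n f.
  move=> n0; elim: d => //= d <-.
  by have [_ _ ->] := j2P (d + n)%N (leq_trans n0 (leq_addl _ _)).
have [w [n0 small]] := lift_factor_small Im1 Im2 z12.
have BL n d f h : (0 < n)%N -> B (d + n)%N (Lzn z1 d f) (Lzn z2 d h) = B n f h.
  by move=> n_gt0; rewrite /B j1L// j2L.
have B0 n f h : (0 < n)%N -> B n f h = 0.
  (* The bound holds from level [n0] on, so both arguments are raised there first. *)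
  move=> n_gt0; rewrite -(BL n n0)//.
  move: (Lzn z1 n0 f) (Lzn z2 n0 h) => {f h}f h.
  have m_gt0 : (0 < n0 + n)%N by rewrite addn_gt0 n_gt0 orbT.
  apply/eqP; rewrite -normr_eq0 -sqrf_eq0; apply/eqP.
  apply: (@small_multiples_eq0 _ _ (dotn f f * dotn h h)) => [||eta eta0].
  - by rewrite exprn_ge0.
  - by rewrite mulr_ge0 ?Existence.dotn_ge0.
  have [d dP] := small _ (leq_addr n n0) eta eta0.
  (* Raising both arguments to a higher level leaves [B] unchanged. *)
  rewrite -(BL _ d f h m_gt0).
  have md : (0 < d + (n0 + n))%N by rewrite addn_gt0 m_gt0 orbT.
  apply: intertwining_form_bound m_gt0 _ _ _ _ dP => *.
  - exact: Bl.
  - exact: Br.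
  - exact: BJM.
  - exact: Bbd.
(* [B] only pairs vectors of the same level. *)
have up1 n m f : (0 < n)%N -> (n <= m)%N -> exists f', j1 m f' = j1 n f.
  by move=> n_gt0 /subnK <-; exists (Lzn z1 (m - n) f); exact: j1L.
have up2 n m f : (0 < n)%N -> (n <= m)%N -> exists f', j2 m f' = j2 n f.
  by move=> n_gt0 /subnK <-; exists (Lzn z2 (m - n) f); exact: j2L.
apply: W1n; apply/seteqP; split=> [x W1x|x ->]; last by case: sW1.
apply: (orthogonal_dense j1dense) => v [n [n_gt0 [f _ <-]]].
have pj0 : p (j1 n f) = 0.
  apply: hdot_eq0; rewrite -Udot//.
  rewrite (_ : U (p (j1 n f)) = 0) ?hdot0//.
  apply: (orthogonal_dense j2dense) => _ [m [m_gt0 [h _ <-]]].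
  have [f' <-] := up1 n (m + n)%N f n_gt0 (leq_addl _ _).
  have [h' <-] := up2 m (m + n)%N h m_gt0 (leq_addr _ _).
  by apply: B0; rewrite addn_gt0 m_gt0.
by rewrite hdotC -[j1 n f]subr0 -pj0 pO// conjC0.
Qed.
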